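(* Let $\Omega\subset\mathbb{C}^d$ be compact, $\mathcal{P}$ a compact parameter set, $(\Omega,\mathfrak{A},\mu)$ a measure space with $\mu(\Omega)<\infty$, and $h:\mathcal{P}\times\Omega\to\mathbb{C}$, $(p,z)\mapsto h_p(z)$, a bounded function with every $h_p$ measurable, such that $p\mapsto h_p$ is sequentially continuous in the sup norm (i.e. $p_i\to p$ in $\mathcal{P}$ implies $\sup_{z\in\Omega}|h_{p_i}(z)-h_p(z)|\to 0$) and such that there is $p\in\mathcal{P}$ for which $h_p$ is not constantly zero. Assume that one of the following conditions is satisfied for some $\varrho>4$: (a) $d=1$, i.e. $\Omega$ is a compact subset of $\mathbb{R}$, and $h$ has the analytic property with respect to $B(\Omega,\varrho)$ in the second argument; (b) $\mathcal{P}$ is a compact subset of $\mathbb{R}$, and $h$ has the analytic property with respect to $B(\mathcal{P},\varrho)$ in the first argument. Then there exists a constant $C>0$ such that for all $p\in\mathcal{P}$ and all $M\in\mathbb{N}$ (for which the magic point interpolation operator $I_M$ is defined), $$\|h-I_M(h)\|_\infty\le C\,M\,(\varrho/4)^{-M},$$ $$\sup_{p\in\mathcal{P}}\big|\mathcal{I}(h_p,\mu)-\mathcal{I}_M(h,\mu)(p)\big|\le C\,\mu(\Omega)\,M\,(\varrho/4)^{-M}.$$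
   Context: Norms. $\mathcal{P}$ is a compact subset of a normed space with norm $\|\cdot\|_\infty$, and $\Omega$ is compact with respect to $\|\cdot\|_\infty$. For functions on $\Omega$, $\|\cdot\|_\infty=\|\cdot\|_{L^\infty}$ is the sup norm; $\|h-I_M(h)\|_\infty=\sup_{(p,z)\in\mathcal{P}\times\Omega}|h_p(z)-I_M(h)(p,z)|$. Magic point interpolation. Magic parameters $p_m^\ast\in\mathcal{P}$, magic points $z_m^\ast\in\Omega$ and basis functions $q_m:\Omega\to\mathbb{C}$ are constructed iteratively. First step: $p_1^\ast\in\operatorname{arg\,max}_{p\in\mathcal{P}}\|h_p\|_{\infty}$, $z_1^\ast\in\operatorname{arg\,max}_{z\in\Omega}|h_{p_1^\ast}(z)|$, $q_1:=h_{p_1^\ast}/h_{p_1^\ast}(z_1^\ast)$. For $M\ge1$ and $1\le m\le M$ set $B^M_{jm}:=q_m(z_j^\ast)$ for $1\le j,m\le M$ (a lower triangular matrix with unit diagonal), $\theta_m^M(z):=\sum_{j=1}^M (B^M)^{-1}_{jm}\,q_j(z)$, and $$I_M(h)(p,z):=\sum_{m=1}^M h_p(z_m^\ast)\,\theta_m^M(z).$$ Recursively, for $M\ge 2$, as long as there are at least $M$ linearly independent functions in $\{h_p\mid p\in\mathcal{P}\}$: $p_M^\ast\in\operatorname{arg\,max}_{p\in\mathcal{P}}\|h_p-I_{M-1}(h)(p,\cdot)\|_{\infty}$, $z_M^\ast\in\operatorname{arg\,max}_{z\in\Omega}|h_{p_M^\ast}(z)-I_{M-1}(h)(p_M^\ast,z)|$,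 $r_M(z):=h_{p_M^\ast}(z)-I_{M-1}(h)(p_M^\ast,z)$, $q_M:=r_M/r_M(z_M^\ast)$. The maximizers are taken to exist; any choice of them is allowed. Integrals. $\mathcal{I}(h_p,\mu):=\int_\Omega h_p(z)\,\mu(dz)$ and $\mathcal{I}_M(h,\mu)(p):=\int_\Omega I_M(h)(p,z)\,\mu(dz)=\sum_{m=1}^M h_p(z_m^\ast)\int_\Omega\theta_m^M(z)\,\mu(dz)$. Bernstein ellipses. For $\varrho>1$, $B([-1,1],\varrho)$ is the open region in $\mathbb{C}$ bounded by the ellipse with foci $\pm1$ whose semiminor and semimajor axis lengths sum to $\varrho$. For real $\underline b<\overline b$, $B([\underline b,\overline b],\varrho)$ is the image of $B([-1,1],\varrho)$ under $\tau_{[\underline b,\overline b]}(x)=\overline b+\frac{\underline b-\overline b}{2}(1-\Re(x))+i\,\frac{\overline b-\underline b}{2}\Im(x)$, $x\in\mathbb{C}$. For a compact $A\subset\mathbb{R}$, $B(A,\varrho):=B([\inf A,\sup A],\varrho)$. Analytic property. Let $f:X_1\times X_2\to\mathbb{C}$ with $X_m\subset\mathbb{C}^{n_m}$ for $m=1,2$. $f$ has the analytic property with respect to $\mathcal{X}_1\subset\mathbb{C}$ in the first argument if $X_1\subset\mathcal{X}_1$ and there exist functions $f_1:X_1\times X_2\to\mathbb{C}$ and $f_2:X_2\to\mathbb{C}$ with $f(x_1,x_2)=f_1(x_1,x_2)f_2(x_2)$ for all $(x_1,x_2)\in X_1\times X_2$, such that $f_1$ has an extension $f_1:\mathcal{X}_1\times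 X_2\to\mathbb{C}$ for which, for every fixed $x_2\in X_2$, $x_1\mapsto f_1(x_1,x_2)$ is analytic in the interior of $\mathcal{X}_1$, and $\sup_{(x_1,x_2)\in\mathcal{X}_1\times X_2}|f_1(x_1,x_2)|\,\sup_{x_2\in X_2}|f_2(x_2)|<\infty$. The analytic property with respect to $\mathcal{X}_2$ in the second argument is defined analogously, with the roles of the two arguments exchanged (so $f(x_1,x_2)=f_1(x_1,x_2)f_2(x_1)$, with $f_1$ extended to $X_1\times\mathcal{X}_2$ and $x_2\mapsto f_1(x_1,x_2)$ analytic). Here $X_1=\mathcal{P}$ and $X_2=\Omega$. *)

(* Defs.v *)
From HB Require Import structures.
From mathcomp Require Import all_boot all_order all_algebra.
From mathcomp Require Import all_classical all_reals all_analysis.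
From mathcomp Require Import complex.
Set Implicit Arguments.
Unset Strict Implicit.
Unset Printing Implicit Defensive.
Import Order.TTheory GRing.Theory Num.Theory.
Import numFieldNormedType.Exports.
Local Open Scope classical_set_scope.
Local Open Scope ring_scope.
Local Open Scope complex_scope.

(* Complex numbers are [R[i]^o]: the regular module carries the usual topology
   of the plane.  Functions on P or Omega are represented by total functions on
   the ambient type; only their values on P and Omega are ever constrained. *)

Section SupNorm.
Context {R : realType} {T : Type}.

(* Extended-real valued, so that an unbounded function has norm +oo. *)
Definition supnorm (X : set T) (f : T -> R[i]^o) : \bar R :=
  ereal_sup [set (Normc.normc (f x))%:E | x in X].

End SupNorm.

Section MagicPoints.
Context {R : realType} {T1 T2 : Type}.
Variables (P : set T1) (Om : set T2) (h : T1 -> T2 -> R[i]^o).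

(* All indices are shifted by one: [ps m], [zs m], [qs m] stand for
   p^*_{m+1}, z^*_{m+1}, q_{m+1}. *)
Variables (ps : nat -> T1) (zs : nat -> T2) (qs : nat -> T2 -> R[i]^o).

Definition magic_matrix (M : nat) : 'M[R[i]]_M :=
  \matrix_(j < M, m < M) qs m (zs j).

Definition magic_theta (M : nat) (m : 'I_M) (z : T2) : R[i]^o :=
  \sum_(j < M) invmx (magic_matrix M) j m * qs j z.

Definition magic_interp (M : nat) (p : T1) (z : T2) : R[i]^o :=
  \sum_(m < M) h p (zs m) * magic_theta m z.

Definition magic_residual (M : nat) (p : T1) (z : T2) : R[i]^o :=
  h p z - magic_interp M p z.

Definition has_independent (M : nat) : Prop :=
  exists g : 'I_M -> T1, (forall i, P (g i)) /\
    forall c : 'I_M -> R[i]^o,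
      (forall z, Om z -> \sum_(i < M) c i * h (g i) z = 0) ->
      forall i, c i = 0.

(* Step m+1 of the construction.  For m = 0 the interpolant [magic_interp 0]
   is the empty sum, so this is also the initial step. *)
Definition magic_step (m : nat) : Prop :=
  [/\ P (ps m) /\ (forall p, P p ->
        (supnorm Om (magic_residual m p)
           <= supnorm Om (magic_residual m (ps m)))%E),
      Om (zs m) /\ (forall z, Om z ->
        Normc.normc (magic_residual m (ps m) z)
          <= Normc.normc (magic_residual m (ps m) (zs m)))
    & forall z, Om z ->
        qs m z = magic_residual m (ps m) z / magic_residual m (ps m) (zs m)].

(* The first M steps have been carried out, so that [magic_interp M] is
   the operator I_M. *)
Definition magic_construction (M : nat) : Prop :=
  forall m, (m < M)%N -> has_independent m.+1 /\ magic_step m.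

End MagicPoints.

Section Analytic.
Context {R : realType}.

(* The open region bounded by the ellipse with semi-axes a (real direction)
   and b; the foci are -1 and 1 iff a^2 - b^2 = 1. *)
Definition bernstein_unit (rho : R) : set R[i]^o :=
  [set z | exists a b : R,
    [/\ 0 < a, 0 < b, a ^+ 2 - b ^+ 2 = 1, a + b = rho
      & (complex.Re z / a) ^+ 2 + (complex.Im z / b) ^+ 2 < 1]].

Definition bernstein_map (lo hi : R) (x : R[i]^o) : R[i]^o :=
  (hi + (lo - hi) / 2 * (1 - complex.Re x)) +i* ((hi - lo) / 2 * complex.Im x).

Definition bernstein_ellipse (A : set R) (rho : R) : set R[i]^o :=
  bernstein_map (inf A) (sup A) @` bernstein_unit rho.

Definition analytic_at (f : R[i]^o -> R[i]^o) (z : R[i]^o) : Prop :=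
  exists a : nat -> R[i]^o,
    \forall w \near z, series (fun k => a k * (w - z) ^+ k) @ \oo --> f w.

(* X1 lies in the real line, embedded in the plane by [%:C]. *)
Definition analytic_property_fst (T2 : Type) (Y1 : set R[i]^o)
    (X1 : set R) (X2 : set T2) (f : R -> T2 -> R[i]^o) : Prop :=
  (forall x, X1 x -> Y1 x%:C) /\
  exists (f1 : R[i]^o -> T2 -> R[i]^o) (f2 : T2 -> R[i]^o),
    [/\ forall x1 x2, X1 x1 -> X2 x2 -> f x1 x2 = f1 x1%:C x2 * f2 x2,
        forall x2, X2 x2 -> forall z, Y1° z -> analytic_at (f1^~ x2) z
      & (supnorm (Y1 `*` X2) (fun x => f1 x.1 x.2) * supnorm X2 f2 < +oo)%E].

Definition analytic_property_snd (T1 : Type) (Y2 : set R[i]^o)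
    (X1 : set T1) (X2 : set R) (f : T1 -> R -> R[i]^o) : Prop :=
  analytic_property_fst Y2 X2 X1 (fun x2 x1 => f x1 x2).

End Analytic.

Section Setting.
Context {R : realType} {T1 : topologicalType} {T2 : ptopologicalType}.
(* The measure space (Om, A, mu).  Library measures live on a whole type, so
   mu is a measure on the sigma-algebra generated by A on T2; the subsets of Om
   in it are exactly the members of A, and only those are ever measured. *)
Variables (P : set T1) (Om : set T2) (A : set (set T2)).
Variable mu : {measure set (g_sigma_algebraType A) -> \bar R}.
Variable h : T1 -> T2 -> R[i]^o.

Definition cintegral (f : T2 -> R[i]^o) : R[i]^o :=
  (\int[mu]_(z in Om) complex.Re (f z)) +i*
  (\int[mu]_(z in Om) complex.Im (f z)).

Record magic_setting : Prop := MagicSetting {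
  setting_compact_param : compact P ;
  setting_compact_domain : compact Om ;
  (* [sigma_algebra Om A] alone does not force the members of A inside Om *)
  setting_subset : forall B, A B -> B `<=` Om ;
  setting_sigma_algebra : sigma_algebra Om A ;
  setting_finite_measure : (mu Om < +oo)%E ;
  setting_bounded : (supnorm (P `*` Om) (fun x => h x.1 x.2) < +oo)%E ;
  setting_measurable : forall p, P p ->
    @measurable_fun _ _ (g_sigma_algebraType A)
      (g_sigma_algebraType (@open R[i]^o)) Om (h p) ;
  setting_continuous : forall (u : nat -> T1) (p : T1),
    (forall i, P (u i)) -> P p -> u @ \oo --> p ->
    (fun i => supnorm Om (fun z => h (u i) z - h p z)) @ \oo --> 0%E ;
  setting_nonzero : exists p z, [/\ P p, Om z & h p z != 0]
}.

Definition magic_convergence (rho : R) : Prop :=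
  forall (ps : nat -> T1) (zs : nat -> T2) (qs : nat -> T2 -> R[i]^o),
  exists2 C : R, 0 < C &
    forall M : nat, (0 < M)%N -> magic_construction P Om h ps zs qs M ->
      (supnorm (P `*` Om)
         (fun x => (h x.1 x.2 - magic_interp h zs qs M x.1 x.2)%R)
       <= (C * M%:R * (rho / 4) ^- M)%:E)%E
      /\
      (supnorm P
         (fun p => (cintegral (h p) - cintegral (magic_interp h zs qs M p))%R)
       <= C%:E * mu Om * (M%:R * (rho / 4) ^- M)%:E)%E.

End Setting.

(* Main.v *)
Require Import Defs.
From HB Require Import structures.
From mathcomp Require Import all_boot all_order all_algebra.
From mathcomp Require Import all_classical all_reals all_analysis.
From mathcomp Require Import complex.
From mathcomp Require Import measurable_realfun.
From mathcomp Require Import ring lra zify.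
Import Order.TTheory GRing.Theory Num.Theory.
Import numFieldNormedType.Exports.
Local Open Scope classical_set_scope.
Local Open Scope ring_scope.
Local Open Scope complex_scope.

(** The residual after M greedy steps is compared with the error of an arbitrary
    separable approximation of rank M; analyticity in one of the two arguments
    provides a separable approximation with error of order rho ^ -M, and the
    comparison costs a factor 2 * 4 ^ M.

    Comparison ([magic_residual_rank_bound]).  Suppose that h differs by at most
    eps from the sum over k < M of a_k(p) b_k(z).  Given p and z, adjoin p to the
    M magic parameters and z to the M magic points.  There are M + 1 points and
    only M functions b_k, so some nonzero combination L of evaluations at these
    points, with weights y, annihilates every b_k; hence |L(h_p')| is at most
    eps |y|_1 for each of the parameters p'.  A step of the construction subtracts
    from the residual of p' a multiple of the residual of the new magic
    parameter, and by the greedy choices the factor has modulus at most one: the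
    bound on L at most doubles.  The same choices show that residuals at most
    double from one step to the next, so the pivot of step k is at least
    2 ^ (k - M) |r_M(p,z)|, where r_M is the residual after M steps.  Dividing
    by the pivots, |L(q_k)| |r_M(p,z)| is at most 2 ^ M eps |y|_1.  The
    weights y are recovered from the values L(q_k) through a unitriangular matrix
    with entries of modulus at most one, at the cost of a factor 2 ^ (M + 1), and
    |y|_1 cancels.

    Approximation ([laurent_approx], [separable_approx]).  After an affine change
    of variable, let f be bounded by V and analytic in the open Bernstein ellipse
    with foci -1 and 1.  With J(u) = (u + 1/u) / 2, y = J(x), |x| = 1 and
    2 <= r < rho, Cauchy's formula on the ellipse J(|u| = r) says that f(y) is the
    mean over the circle |u| = r of f(J(u)) times the kernel
    1 + sum over k >= 1 of (x^k + x^-k) u^-k.  Keeping the terms k < M leaves a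
    combination of M functions of x with coefficients depending on f only, and an
    error at most 4 V r ^ -M.

    A discrete form of Cauchy's formula is enough ([polygon_cauchy]).  Take for
    w_j the images under J of the points r times the N-th roots of unity, and let
    the polygon contract to y: the points w_j are replaced by y + t (w_j - y).
    The sum of f(y + t (w_j - y)) (w_{j+1} - w_j) / (w_j - y) changes with t
    by a multiple of the sum of the differences of f between
    consecutive vertices, which is zero around a closed polygon, up to an error
    controlled by second divided differences of f.  These are bounded near each
    point by the power series expansion, and uniformly on a closed ellipse by
    compactness.

    The bound for the integrals follows by integrating the residual over a set of
    finite measure. *)

Notation normc := Normc.normc.

Arguments Normc.normc : simpl never.

(** * The modulus as a real number *)

Section ComplexModulus.
Context {R : realType}.
Implicit Types x y z : R[i].

Lemma normc_ge0 x : 0 <= normc x.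
Proof. by case: x => a b; exact: sqrtr_ge0. Qed.

Lemma normc_eq0 x : (normc x == 0) = (x == 0).
Proof. by apply/eqP/eqP => [/Normc.eq0_normc //|->]; exact: Normc.normc0. Qed.

Lemma normc_gt0 x : (0 < normc x) = (x != 0).
Proof. by rewrite lt_def normc_ge0 andbT normc_eq0. Qed.

Lemma normcD x y : normc (x + y) <= normc x + normc y.
Proof. exact: (@ler_normD R (Rcomplex R)). Qed.

Lemma normcB x y : normc (x - y) <= normc x + normc y.
Proof. exact: (@ler_normB R (Rcomplex R)). Qed.

Lemma normc_opp x : normc (- x) = normc x.
Proof. exact: (@normrN R (Rcomplex R)). Qed.

Lemma normc_sub x y : normc (x - y) = normc (y - x).
Proof. exact: (@distrC R (Rcomplex R)). Qed.

Lemma normc_sum (I : Type) (r : seq I) (D : pred I) (F : I -> R[i]) :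
  normc (\sum_(i <- r | D i) F i) <= \sum_(i <- r | D i) normc (F i).
Proof. exact: (@ler_norm_sum R (Rcomplex R)). Qed.

Lemma normc_dist x y z : normc (x - z) <= normc (x - y) + normc (y - z).
Proof. exact: (@ler_distD R (Rcomplex R)). Qed.

Lemma normc_real (a : R) : normc a%:C = `|a|.
Proof. by rewrite /Normc.normc /= expr0n addr0 sqrtr_sqr. Qed.

Lemma normcX x n : normc (x ^+ n) = normc x ^+ n.
Proof.
elim: n => [|n IH]; first by rewrite !expr0 Normc.normc1.
by rewrite !exprS Normc.normcM IH.
Qed.

Lemma norm_normc (x : R[i]^o) : `|x| = (normc x)%:C.
Proof. by case: x. Qed.

End ComplexModulus.

(** Used both for linear dependence of functions and for functionals that
    annihilate fewer functions than there are points. *)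
Lemma exists_left_kernel (F : fieldType) (m : nat) (A : 'M[F]_(m.+1, m)) :
  exists2 c : 'rV[F]_m.+1, c != 0 & c *m A = 0.
Proof.
have : kermx A != 0.
  by rewrite kermx_eq0 /row_free neq_ltn ltnS rank_leq_col.
by case/rowV0Pn => c /sub_kermxP cA c0; exists c.
Qed.

(** * Greedy interpolation against separable approximation *)

Section GreedyInterpolation.
Context {R : realType} {T1 T2 : Type}.
Variables (P : set T1) (Om : set T2) (h : T1 -> T2 -> R[i]^o).
Variables (ps : nat -> T1) (zs : nat -> T2) (qs : nat -> T2 -> R[i]^o).

Local Notation interp := (magic_interp h zs qs).
Local Notation res := (magic_residual h zs qs).

(** The coefficients are those of the interpolation problem at the magic points:
    the inverse matrix in the definition of the operator solves it. *)
Lemma magic_interp_span M p : exists c : nat -> R[i],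
  (forall z, interp M p z = \sum_(j < M) c j * qs j z) /\
  (magic_matrix zs qs M \in unitmx ->
    forall i, (i < M)%N -> \sum_(j < M) c j * qs j (zs i) = h p (zs i)).
Proof.
pose v : 'cV[R[i]]_M := \col_m h p (zs m).
pose c := invmx (magic_matrix zs qs M) *m v.
exists (fun j => if insub j is Some j' then c j' 0 else 0); split.
  move=> z; rewrite /magic_interp /magic_theta.
  under eq_bigr do rewrite mulr_sumr.
  rewrite exchange_big /=; apply: eq_bigr => j _.
  rewrite valK /c mxE mulr_suml; apply: eq_bigr => m _.
  by rewrite !mxE mulrA [_ * h _ _]mulrC.
move=> U i iM.
have : (magic_matrix zs qs M *m c) (Ordinal iM) 0 = v (Ordinal iM) 0.
  by rewrite /c mulKVmx.
rewrite !mxE /= => <-; apply: eq_bigr => j _.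
by rewrite valK !mxE mulrC.
Qed.

(** Two interpolating combinations have coefficients differing by a kernel vector
    of an invertible matrix. *)
Lemma magic_interp_unique M p (d : nat -> R[i]) :
  magic_matrix zs qs M \in unitmx ->
  (forall i, (i < M)%N -> \sum_(j < M) d j * qs j (zs i) = h p (zs i)) ->
  forall z, interp M p z = \sum_(j < M) d j * qs j z.
Proof.
move=> U dP z; have [c [-> /(_ U) cP]] := magic_interp_span M p.
pose e : 'cV[R[i]]_M := \col_j (c j - d j).
suff e0 : e = 0.
  apply: eq_bigr => j _; congr (_ * _); apply/eqP; rewrite -subr_eq0.
  by have := congr1 (fun w : 'cV[R[i]]_M => w j 0) e0; rewrite !mxE => /eqP.
rewrite -(mulKmx U e) (_ : _ *m e = 0) ?mulmx0 //.
apply/matrixP => i k; rewrite !mxE.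
transitivity (\sum_(j < M) (c j * qs j (zs i) - d j * qs j (zs i))).
  by apply: eq_bigr => j _; rewrite !mxE mulrBr ![qs _ _ * _]mulrC.
by rewrite sumrB cP ?dP ?subrr.
Qed.

Lemma magic_residual_node M p i :
  magic_matrix zs qs M \in unitmx -> (i < M)%N -> res M p (zs i) = 0.
Proof.
move=> U iM; have [c [cE /(_ U) cP]] := magic_interp_span M p.
by rewrite /magic_residual cE cP ?subrr.
Qed.

Lemma magic_residual0 p z : res 0 p z = h p z.
Proof. by rewrite /magic_residual /magic_interp big_ord0 subr0. Qed.

(** A zero pivot would make every residual vanish on the domain, hence put all
    h_p in the span of [m] functions, against the independence of [m.+1] of them. *)
Lemma magic_pivot_neq0 m : has_independent P Om h m.+1 ->
  magic_step P Om h ps zs qs m -> res m (ps m) (zs m) != 0.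
Proof.
move=> [g [gP gfree]] [[_ pmax] [_ zmax] _].
apply/eqP => r0.
have res0 p z : P p -> Om z -> res m p z = 0.
  move=> Pp Oz; apply/eqP; rewrite -normc_eq0 eq_le normc_ge0 andbT -lee_fin.
  apply: le_trans (ereal_sup_ubound _) (le_trans (pmax p Pp) _).
    by exists z.
  apply: ge_ereal_sup => _ [y Oy <-]; rewrite lee_fin.
  by have := zmax y Oy; rewrite r0 Normc.normc0.
have [c c0 cA] := @exists_left_kernel _ m (\matrix_(i, j) h (g i) (zs j)).
case/negP: c0; apply/eqP/matrixP => k i; rewrite ord1 mxE {k}.
apply: (gfree (c 0)) => z Oz.
transitivity (\sum_(i < m.+1) \sum_(j < m)
    c 0 i * h (g i) (zs j) * magic_theta zs qs j z).
  apply: eq_bigr => j _; have /eqP := res0 (g j) z (gP j) Oz.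
  rewrite subr_eq0 => /eqP ->; rewrite /magic_interp mulr_sumr.
  by apply: eq_bigr => l _; rewrite mulrA.
rewrite exchange_big /= big1 // => j _; rewrite -mulr_suml.
have := congr1 (fun w : 'rV[R[i]]_m => w 0 j) cA; rewrite !mxE.
under eq_bigr do rewrite mxE.
by move=> ->; rewrite mul0r.
Qed.

Variable M : nat.
Hypothesis constr : magic_construction P Om h ps zs qs M.

Lemma magic_param_in m : (m < M)%N -> P (ps m).
Proof. by case/constr => _ [[]]. Qed.

Lemma magic_point_in m : (m < M)%N -> Om (zs m).
Proof. by case/constr => _ [_ []]. Qed.

Lemma magic_basisE m z : (m < M)%N -> Om z ->
  qs m z = res m (ps m) z / res m (ps m) (zs m).
Proof. by case/constr => _ [_ _]; apply. Qed.

Lemma magic_pivot m : (m < M)%N -> res m (ps m) (zs m) != 0.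
Proof. by case/constr => hi; exact: magic_pivot_neq0. Qed.

(** The two maximisations combined: the pivot is the sup norm of the residual
    over both arguments. *)
Lemma magic_pivot_max m p z : (m < M)%N -> P p -> Om z ->
  normc (res m p z) <= normc (res m (ps m) (zs m)).
Proof.
case/constr => _ [[_ pmax] [_ zmax] _] Pp Oz.
rewrite -lee_fin.
apply: le_trans (ereal_sup_ubound _) (le_trans (pmax p Pp) _).
  by exists z.
by apply: ge_ereal_sup => _ [y Oy <-]; rewrite lee_fin zmax.
Qed.

Lemma magic_basis_diag m : (m < M)%N -> qs m (zs m) = 1.
Proof.
by move=> mM; rewrite magic_basisE ?divff ?magic_pivot //; exact: magic_point_in.
Qed.

Lemma magic_basis_le1 m z : (m < M)%N -> Om z -> normc (qs m z) <= 1.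
Proof.
move=> mM Oz; rewrite magic_basisE // Normc.normcM Normc.normcV.
rewrite ler_pdivrMr ?normc_gt0 ?magic_pivot // mul1r.
by apply: magic_pivot_max => //; exact: magic_param_in.
Qed.

(** Unitriangularity of the matrix, the vanishing of residuals at earlier points
    and the vanishing of later basis functions there depend on each other and are
    proved by one induction on the size. *)
Lemma magic_matrix_unit m : (m <= M)%N -> magic_matrix zs qs m \in unitmx.
Proof.
elim/ltn_ind: m => m IH mM.
have trig : is_trig_mx (magic_matrix zs qs m).
  apply/is_trig_mxP => i j ij; rewrite mxE.
  have jM : (j < M)%N := leq_trans (ltn_ord j) mM.
  rewrite magic_basisE //; last by apply: magic_point_in; exact: ltn_trans jM.
  by rewrite magic_residual_node ?mul0r // IH // ltnW.
rewrite unitmxE det_trig // big1 ?unitr1 // => i _.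
by rewrite mxE magic_basis_diag // (leq_trans (ltn_ord i)).
Qed.

Lemma magic_node m p i : (m <= M)%N -> (i < m)%N -> res m p (zs i) = 0.
Proof. by move=> mM im; rewrite magic_residual_node ?magic_matrix_unit. Qed.

Lemma magic_basis_node m i : (i < m < M)%N -> qs m (zs i) = 0.
Proof.
move=> /andP[im mM]; rewrite magic_basisE //; last first.
  by apply: magic_point_in; exact: ltn_trans mM.
by rewrite magic_node ?mul0r // ltnW.
Qed.

(** The Newton form of the interpolation: the correction is the multiple of the
    new basis function that fits the new point, and it does not disturb the
    earlier points. *)
Lemma magic_residualS m p z : (m < M)%N ->
  res m.+1 p z = res m p z - res m p (zs m) * qs m z.
Proof.
move=> mM; have Um := magic_matrix_unit m (ltnW mM).
have [c [cE /(_ Um) cP]] := magic_interp_span m p.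
pose d j := if j == m then res m p (zs m) else c j.
have sumd w : \sum_(j < m.+1) d j * qs j w =
    interp m p w + res m p (zs m) * qs m w.
  rewrite big_ord_recr /= /d eqxx cE; congr (_ + _); apply: eq_bigr => j _.
  by rewrite (ltn_eqF (ltn_ord j)).
rewrite {1}/magic_residual (@magic_interp_unique _ _ d) ?magic_matrix_unit //.
  by rewrite sumd /magic_residual opprD addrA.
move=> i; rewrite ltnS leq_eqVlt => /predU1P[->|im].
  by rewrite sumd magic_basis_diag // mulr1 /magic_residual addrC subrK.
by rewrite sumd magic_basis_node ?im // mulr0 addr0 cE cP.
Qed.

(** Both terms of the Newton step are at most the pivot, since the basis
    functions have modulus at most one. *)
Lemma magic_residual_double m p z : (m < M)%N -> P p -> Om z ->
  normc (res m.+1 p z) <= 2 * normc (res m (ps m) (zs m)).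
Proof.
move=> mM Pp Oz; rewrite magic_residualS //.
apply: le_trans (normcB _ _) _; rewrite mulr_natl mulr2n.
apply: lerD; first exact: magic_pivot_max.
rewrite Normc.normcM -[leRHS]mulr1.
apply: ler_pM; rewrite ?normc_ge0 ?magic_basis_le1 //.
by apply: magic_pivot_max => //; exact: magic_point_in.
Qed.

Lemma magic_residual_pivot m p z : (m < M)%N -> P p -> Om z ->
  normc (res M p z) <= 2 ^+ (M - m) * normc (res m (ps m) (zs m)).
Proof.
move=> mM Pp Oz.
suff H k : (m + k < M)%N -> forall p' z', P p' -> Om z' ->
    normc (res (m + k).+1 p' z') <= 2 ^+ k.+1 * normc (res m (ps m) (zs m)).
  have [k Mk] : exists k, M = (m + k).+1.
    by exists (M - m.+1)%N; rewrite -addSn subnKC.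
  have mkM : (m + k < M)%N by rewrite Mk.
  have -> : (M - m = k.+1)%N by rewrite Mk -addnS addKn.
  by rewrite Mk; exact: H.
elim: k => [|k IH] kM p' z' Pp' Oz'.
  by rewrite addn0 expr1; exact: magic_residual_double.
rewrite addnS in kM *.
apply: le_trans (magic_residual_double _ _ _ kM Pp' Oz') _.
rewrite exprS -mulrA ler_pM2l //.
by apply: IH; [exact: ltnW | exact: magic_param_in | exact: magic_point_in].
Qed.

(** The greedy error is at most 2 * 4 ^ M times the error of any separable
    approximation of rank [M]: a factor 2 ^ M for the growth of a functional along
    the greedy steps, and 2 ^ (M + 1) for inverting the triangular matrix. *)
Lemma magic_residual_rank_bound (eps : R) (a : nat -> T1 -> R[i])
    (b : nat -> T2 -> R[i]) :
  (forall p z, P p -> Om z ->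
    normc (h p z - \sum_(k < M) a k p * b k z) <= eps) ->
  forall p z, P p -> Om z -> normc (res M p z) <= 2 * 4 ^+ M * eps.
Proof.
move=> approx p z Pp Oz.
pose X i := if (i < M)%N then ps i else p.
pose Z j := if (j < M)%N then zs j else z.
have XP i : P (X i) by rewrite /X; case: ifP => // /magic_param_in.
have ZO j : Om (Z j) by rewrite /Z; case: ifP => // /magic_point_in.
have [y' y'0 y'b] := @exists_left_kernel _ M (\matrix_(j, k) b k (Z j)).
pose y j := if insub j is Some j' then y' 0 j' else 0.
have yb k : (k < M)%N -> \sum_(j < M.+1) y j * b k (Z j) = 0.
  move=> kM; have := congr1 (fun w : 'rV[R[i]]_M => w 0 (Ordinal kM)) y'b.
  rewrite !mxE => E; rewrite -[RHS]E; apply: eq_bigr => j _.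
  by rewrite /y valK mxE.
pose S k := \sum_(k <= j < M.+1) normc (y j).
have S0 : 0 < S 0%N.
  rewrite /S big_mkord; have [le0|//] := leP (\sum_(j < M.+1) normc (y j)) 0.
  have sum0 : \sum_(j < M.+1) normc (y j) = 0.
    by apply/eqP; rewrite eq_le le0 sumr_ge0 // => j _; exact: normc_ge0.
  case/negP: y'0; apply/eqP/matrixP => r j; rewrite ord1 mxE {r}.
  move/psumr_eq0P: sum0 => /(_ (fun i _ => normc_ge0 (y i)) j isT) /eqP.
  by rewrite normc_eq0 /y valK => /eqP.
(* [L] does not see the separable approximant, only its error; a greedy step at
   most doubles what it sees. *)
pose L (g : T2 -> R[i]) := \sum_(j < M.+1) y j * g (Z j).
have L_res m : (m <= M)%N -> forall i,
    normc (L (res m (X i))) <= 2 ^+ m * (eps * S 0%N).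
  elim: m => [_ i|m IH mM i].
    rewrite expr0 mul1r.
    have -> : L (res 0 (X i)) =
        L (fun w => h (X i) w - \sum_(k < M) a k (X i) * b k w).
      rewrite /L; under [RHS]eq_bigr do rewrite mulrBr.
      rewrite sumrB [X in _ - X](_ : _ = 0) ?subr0.
        by apply: eq_bigr => j _; rewrite magic_residual0.
      under eq_bigr do rewrite mulr_sumr.
      rewrite exchange_big big1 // => k _ /=.
      under eq_bigr do rewrite mulrCA.
      by rewrite -mulr_sumr yb ?mulr0.
    apply: le_trans (normc_sum _ _ _ _) _.
    rewrite /S big_mkord mulr_sumr; apply: ler_sum => j _.
    by rewrite Normc.normcM mulrC ler_wpM2r ?normc_ge0 ?approx.
  pose q := res m (X i) (zs m) / res m (ps m) (zs m).
  have -> : L (res m.+1 (X i)) = L (res m (X i)) - q * L (res m (ps m)).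
    rewrite /L mulr_sumr -sumrB; apply: eq_bigr => j _.
    rewrite magic_residualS // magic_basisE // mulrBr; congr (_ - _).
    by rewrite /q [LHS]mulrCA -[RHS]mulrA; congr (_ * _); rewrite [RHS]mulrC !mulrA.
  have q1 : normc q <= 1.
    rewrite Normc.normcM Normc.normcV ler_pdivrMr ?normc_gt0 ?magic_pivot // mul1r.
    by apply: magic_pivot_max => //; exact: magic_point_in.
  apply: le_trans (normcB _ _) _.
  rewrite exprS -mulrA mulr_natl mulr2n; apply: lerD; first exact/IH/ltnW.
  rewrite Normc.normcM -[leRHS]mul1r; apply: ler_pM; rewrite ?normc_ge0 //.
  have := IH (ltnW mM) m; rewrite /X mM; exact.
set e := normc (res M p z).
(* At step [k < M] the residual of [ps k] is its pivot times [qs k], so the bound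
   on [L] gives a bound on [L (qs k)].  The extra pair (p, z) plays the role of
   step [M], with a basis function vanishing at the first [M] points. *)
pose w k := if (k < M)%N then L (qs k) else y M.
have w_le k : (k <= M)%N -> e * normc (w k) <= 2 ^+ M * (eps * S 0%N).
  rewrite leq_eqVlt /w => /predU1P[->|kM].
    rewrite ltnn -Normc.normcM; have := L_res M (leqnn M) M.
    rewrite /X ltnn; congr (normc _ <= _); rewrite /L big_ord_recr /= big1 => [|j _].
      by rewrite add0r /Z ltnn mulrC.
    by rewrite /Z ltn_ord magic_node ?mulr0.
  rewrite kM; have := L_res k (ltnW kM) k; rewrite {1}/X kM.
  have -> : L (res k (ps k)) = res k (ps k) (zs k) * L (qs k).
    rewrite /L mulr_sumr; apply: eq_bigr => j _.
    rewrite magic_basisE // mulrCA; congr (_ * _).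
    by rewrite mulrC divfK ?magic_pivot.
  rewrite Normc.normcM => Lk.
  apply: (@le_trans _ _ (2 ^+ (M - k) * (2 ^+ k * (eps * S 0%N)))); last first.
    by rewrite mulrA -exprD subnK // ltnW.
  apply: le_trans (_ : _ <= 2 ^+ (M - k) *
    (normc (res k (ps k) (zs k)) * normc (L (qs k)))) _.
    by rewrite mulrA ler_wpM2r ?normc_ge0 ?magic_residual_pivot.
  by rewrite ler_wpM2l ?exprn_ge0.
(* Back substitution: the matrix of the [qs k (Z j)] is unitriangular with
   entries of modulus at most one, so each step at most doubles the tail sums. *)
have y_le k : (k <= M)%N -> normc (y k) <= normc (w k) + S k.+1.
  rewrite leq_eqVlt /w => /predU1P[->|kM].
    by rewrite ltnn lerDl sumr_ge0 // => j _; exact: normc_ge0.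
  rewrite kM.
  have LE : L (qs k) = y k + \sum_(k.+1 <= j < M.+1) y j * qs k (Z j).
    rewrite /L -(big_mkord predT (fun j => y j * qs k (Z j))).
    rewrite (@big_cat_nat _ _ _ k) //=; last by rewrite ltnW // ltnW.
    rewrite big_nat_cond big1 => [|j /andP[/andP[_ jk] _]].
      by rewrite add0r big_ltn ?ltnS 1?ltnW // /Z kM magic_basis_diag ?mulr1.
    by rewrite /Z (ltn_trans jk kM) magic_basis_node ?mulr0 // jk.
  have -> : y k = L (qs k) - \sum_(k.+1 <= j < M.+1) y j * qs k (Z j).
    by rewrite LE addrK.
  apply: le_trans (normcB _ _) _; rewrite lerD2l.
  apply: le_trans (normc_sum _ _ _ _) _; apply: ler_sum => j _.
  rewrite Normc.normcM -[leRHS]mulr1; apply: ler_pM; rewrite ?normc_ge0 //.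
  exact: magic_basis_le1.
have S_le k : (k <= M.+1)%N ->
    e * S (M.+1 - k)%N <= (2 ^+ k - 1) * (2 ^+ M * (eps * S 0%N)).
  elim: k => [_|k IH kM].
    by rewrite subn0 /S big_geq // mulr0 expr0 subrr mul0r.
  have kM' : (M.+1 - k.+1 <= M)%N by rewrite leq_subLR; lia.
  have SE : S (M.+1 - k.+1)%N = normc (y (M.+1 - k.+1)%N) + S (M.+1 - k)%N.
    by rewrite /S big_ltn ?ltnS // -subSn // subSS.
  have := y_le _ kM'; rewrite -subSn // subSS => yk.
  have e0 : 0 <= e by exact: normc_ge0.
  have := ler_wpM2l e0 yk; have := IH (ltnW kM); have := w_le _ kM'.
  rewrite SE mulrDr mulrDr exprS.
  set t := 2 ^+ M * _; set A := e * normc (w _); set B := e * S _.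
  set D := e * normc _; set E2 := 2 ^+ k => h1 h2 h3.
  by have -> : (2 * E2 - 1) * t = (E2 - 1) * t + (E2 - 1) * t + t; [ring|lra].
have := S_le M.+1 (leqnn _); rewrite subnn.
rewrite !mulrA ler_pM2r // => /le_trans; apply.
have eps0 : 0 <= eps by exact: le_trans (normc_ge0 _) (approx p z Pp Oz).
have -> : 4 ^+ M = 2 ^+ M * 2 ^+ M :> R by rewrite -exprMn -natrM.
by rewrite ler_wpM2r // [leRHS]mulrA ler_wpM2r ?exprn_ge0 // -exprS gerBl.
Qed.

End GreedyInterpolation.

(** * Second divided differences of analytic functions *)

Section SecondDifference.
Context {R : realType}.
Implicit Types (f : R[i] -> R[i]) (z u v w : R[i]).

Lemma nbhs_normcP (z : R[i]^o) (A : set R[i]^o) :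
  nbhs z A <-> exists2 e : R, 0 < e & forall w, normc (w - z) < e -> A w.
Proof.
split=> [/nbhs_normP[e /= e0 eA]|[e e0 eA]].
  have eE : e = (complex.Re e)%:C by rewrite RRe_real // gtr0_real.
  exists (complex.Re e); first by move: e0; rewrite {1}eE ltcR.
  move=> w wz; apply: eA => /=; rewrite distrC norm_normc eE ltcR; exact: wz.
apply/(@nbhs_normP R[i] R[i]^o); exists e%:C; first by rewrite /= ltcR.
by move=> w /=; rewrite distrC norm_normc ltcR; exact: eA.
Qed.

Lemma cvg_normc (s : nat -> R[i]^o) (l : R[i]^o) : s @ \oo --> l ->
  forall e : R, 0 < e -> exists n0, forall n, (n0 <= n)%N -> normc (s n - l) < e.
Proof.
move=> /cvgrPdist_lt sl e e0.
have [|n0 _ H] := sl e%:C; first by rewrite ltcR.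
exists n0 => n n0n; have := H n n0n => /=.
by rewrite distrC norm_normc ltcR.
Qed.

(** A bound on the second divided difference of [f] at u, v1, v2, cleared of
    denominators.  This form of twice differentiability with bounded second
    derivative mentions no derivative, so it passes to limits of partial sums
    pointwise. *)
Definition second_diff_bound f (d K : R) u :=
  forall v1 v2, normc (v1 - u) < d -> normc (v2 - u) < d ->
  normc ((f v1 - f u) * (v2 - u) - (f v2 - f u) * (v1 - u)) <=
  K * (normc (v1 - u) * normc (v2 - u) * normc (v1 - v2)).

Definition locally_second_diff f z :=
  exists K d : R, 0 < d /\ forall u, normc (u - z) < d -> second_diff_bound f d K u.

(** The true constant is k r ^ (k - 1); the powers of two avoid exponents that
    depend on subtraction. *)
Lemma diff_pow_bound (r : R) u v k : 0 <= r -> normc u <= r -> normc v <= r ->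
  r * normc (v ^+ k - u ^+ k) <= (2 * r) ^+ k * normc (v - u).
Proof.
move=> r0 ur vr; elim: k => [|k IH].
  by rewrite !expr0 subrr Normc.normc0 mulr0 mul1r normc_ge0.
have -> : v ^+ k.+1 - u ^+ k.+1 = v * (v ^+ k - u ^+ k) + (v - u) * u ^+ k.
  by rewrite !exprS; ring.
have h1 : r * normc (v * (v ^+ k - u ^+ k)) <= r * ((2 * r) ^+ k * normc (v - u)).
  rewrite Normc.normcM mulrCA; apply: ler_pM; rewrite ?normc_ge0 //.
  by rewrite mulr_ge0 ?normc_ge0.
have h2 : r * normc ((v - u) * u ^+ k) <= r * ((2 * r) ^+ k * normc (v - u)).
  rewrite ler_wpM2l // Normc.normcM mulrC ler_wpM2r ?normc_ge0 // normcX.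
  by apply: lerXn2r; rewrite ?nnegrE ?normc_ge0 ?mulr_ge0 //; lra.
apply: le_trans (ler_wpM2l r0 (normcD _ _)) _.
rewrite mulrDr exprS; set t := _ ^+ k * _ in h1 h2; rewrite -mulrA -/t; lra.
Qed.

(** The second difference of the power k + 1 is v2 times that of the power k plus
    a first difference of the power k; the constant 4 ^ k absorbs the resulting
    quadratic factor in k. *)
Lemma second_diff_pow_bound (r : R) u v1 v2 k : 0 <= r ->
  normc u <= r -> normc v1 <= r -> normc v2 <= r ->
  r ^+ 2 * normc ((v1 ^+ k - u ^+ k) * (v2 - u) - (v2 ^+ k - u ^+ k) * (v1 - u))
  <= (4 * r) ^+ k * (normc (v1 - u) * normc (v2 - u) * normc (v1 - v2)).
Proof.
move=> r0 ur v1r v2r; set p := _ * normc (v1 - v2).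
have p0 : 0 <= p by rewrite !mulr_ge0 ?normc_ge0.
elim: k => [|k IH].
  by rewrite !expr0 !subrr !mul0r subrr Normc.normc0 mulr0 mul1r.
set D := _ - _ in IH.
have -> : (v1 ^+ k.+1 - u ^+ k.+1) * (v2 - u) - (v2 ^+ k.+1 - u ^+ k.+1) * (v1 - u)
    = v2 * D + (v1 ^+ k - u ^+ k) * ((v2 - u) * (v1 - v2)).
  by rewrite /D !exprS; ring.
have h1 : r ^+ 2 * normc (v2 * D) <= r * ((4 * r) ^+ k * p).
  rewrite Normc.normcM mulrCA; apply: ler_pM; rewrite ?normc_ge0 //.
  by rewrite mulr_ge0 ?normc_ge0 ?exprn_ge0.
have h2 : r ^+ 2 * normc ((v1 ^+ k - u ^+ k) * ((v2 - u) * (v1 - v2))) <=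
    r * ((4 * r) ^+ k * p).
  rewrite !Normc.normcM expr2 -mulrA ler_wpM2l //.
  have := @diff_pow_bound r u v1 k r0 ur v1r.
  set A := normc (_ ^+ k - _) => HA.
  have -> : r * (A * (normc (v2 - u) * normc (v1 - v2))) =
      r * A * (normc (v2 - u) * normc (v1 - v2)) by ring.
  apply: le_trans (ler_wpM2r _ HA) _; first by rewrite mulr_ge0 ?normc_ge0.
  rewrite /p -!mulrA ler_wpM2r ?mulr_ge0 ?normc_ge0 //.
  by apply: lerXn2r; rewrite ?nnegrE ?mulr_ge0 //; lra.
apply: le_trans (ler_wpM2l _ (normcD _ _)) _; first by rewrite exprn_ge0.
rewrite mulrDr [(4 * r) ^+ k.+1]exprS; set t := (4 * r) ^+ k * p in h1 h2.
have -> : 4 * r * (4 * r) ^+ k * p = 4 * (r * t) by rewrite /t; ring.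
have : 0 <= r * t by rewrite mulr_ge0 // /t mulr_ge0 // exprn_ge0 // mulr_ge0.
lra.
Qed.

Lemma cvg_series_bounded_terms (t : nat -> R[i]^o) (l : R[i]^o) :
  series t @ \oo --> l -> exists2 B : R, 0 <= B & forall k, normc (t k) <= B.
Proof.
move=> /cvg_normc /(_ 1 ltr01) [n0 H].
exists (2 + \sum_(k < n0) normc (t k)).
  by rewrite addr_ge0 // sumr_ge0 // => k _; exact: normc_ge0.
move=> k; have [kn|nk] := ltnP k n0.
  rewrite (bigD1 (Ordinal kn)) //= addrCA lerDl addr_ge0 //.
  by rewrite sumr_ge0 // => j _; exact: normc_ge0.
apply: (@le_trans _ _ 2); last first.
  by rewrite lerDl sumr_ge0 // => j _; exact: normc_ge0.
have -> : t k = (series t k.+1 - l) - (series t k - l).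
  by rewrite /series /= big_nat_recr //= opprB addrA subrK [X in X - _]addrC addrK.
have := H k nk; have := H k.+1 (leqW nk).
have := normcB (series t k.+1 - l) (series t k - l).
lra.
Qed.

Lemma half_geometric_le2 n : \sum_(k < n) (2^-1 : R) ^+ k <= 2.
Proof.
suff -> : \sum_(k < n) (2^-1 : R) ^+ k = 2 - 2 * 2^-1 ^+ n.
  by rewrite gerBl mulr_ge0 // exprn_ge0.
elim: n => [|n IH]; first by rewrite big_ord0 expr0; ring.
by rewrite big_ord_recr /= IH exprS; field.
Qed.

(** Each partial sum of the power series satisfies the bound with the same
    constant, because its terms decay geometrically on a smaller disc. *)
Lemma analytic_second_diff_bound f z : analytic_at f z ->
  locally_second_diff f z.
Proof.
case=> a /nbhs_normcP[e e0 H].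
pose s w n := \sum_(k < n) a k * (w - z) ^+ k.
have sf w : normc (w - z) < e ->
    forall t : R, 0 < t -> exists n0, forall n, (n0 <= n)%N -> normc (s w n - f w) < t.
  move=> we t t0; have [n0 Hn] := cvg_normc _ _ (H w we) t t0.
  by exists n0 => n /Hn; rewrite /series /= big_mkord.
have e20 : 0 < e / 2 by lra.
have [B B0 Bk] : exists2 B : R, 0 <= B & forall k, normc (a k) * (e / 2) ^+ k <= B.
  have : normc ((z + (e / 2)%:C) - z) < e.
    by rewrite addrC addKr normc_real gtr0_norm //; lra.
  move=> /H /cvg_series_bounded_terms[B B0 Bk]; exists B => // k.
  have := Bk k; rewrite Normc.normcM normcX [X in normc (X - z)]addrC addrK normc_real.
  by rewrite gtr0_norm.
(* The terms of the series at distance e / 2 from z are bounded by B.  On the disc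
   of radius e / 16 the k-th term of the second difference is then B / 2 ^ k up to
   a constant, as 4 * (e / 16) is half of e / 2. *)
pose r := e / 16; have r0 : 0 < r by rewrite /r; lra.
exists (B * 2 / r ^+ 2), (r / 2); split; first lra.
move=> u uz v1 v2 v1u v2u.
have v1z : normc (v1 - z) < r by have := normc_dist v1 u z; lra.
have v2z : normc (v2 - z) < r by have := normc_dist v2 u z; lra.
set p := _ * normc (v1 - v2).
have p0 : 0 <= p by rewrite !mulr_ge0 ?normc_ge0.
have partial n :
    normc ((s v1 n - s u n) * (v2 - u) - (s v2 n - s u n) * (v1 - u)) <=
    B * 2 / r ^+ 2 * p.
  pose D k := ((v1 - z) ^+ k - (u - z) ^+ k) * (v2 - u) -
              ((v2 - z) ^+ k - (u - z) ^+ k) * (v1 - u).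
  have -> : (s v1 n - s u n) * (v2 - u) - (s v2 n - s u n) * (v1 - u) =
      \sum_(k < n) a k * D k.
    rewrite /s -!sumrB !mulr_suml -sumrB; apply: eq_bigr => k _.
    by rewrite /D; ring.
  rewrite mulrAC ler_pdivlMr ?exprn_gt0 // [leLHS]mulrC.
  apply: le_trans (ler_wpM2l _ (normc_sum _ _ _ _)) _; first by rewrite exprn_ge0 // ltW.
  rewrite mulr_sumr.
  have term k : r ^+ 2 * normc (a k * D k) <= 2^-1 ^+ k * (B * p).
    have := @second_diff_pow_bound r (u - z) (v1 - z) (v2 - z) k.
    have E (x y : R[i]) : x - z - (y - z) = x - y by ring.
    rewrite !E -/(D k) -/p => /(_ (ltW r0) _ (ltW v1z) (ltW v2z)) HD.
    have {}HD := HD ltac:(clear -uz r0; lra).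
    rewrite Normc.normcM mulrCA.
    apply: le_trans (ler_wpM2l (normc_ge0 _) HD) _.
    rewrite mulrA [leRHS]mulrA ler_wpM2r //.
    have -> : 4 * r = (e / 2) / 2 by rewrite /r; field.
    by rewrite exprMn mulrA mulrC ler_wpM2l ?exprn_ge0 // Bk.
  apply: (@le_trans _ _ (\sum_(k < n) 2^-1 ^+ k * (B * p))).
    by apply: ler_sum => k _; exact: term.
  rewrite -mulr_suml -mulrA [B * (2 * p)]mulrCA.
  by rewrite ler_wpM2r ?half_geometric_le2 // mulr_ge0.
apply/ler_addgt0Pr => t t0.
pose c := normc (v1 - u) + normc (v2 - u).
have c0 : 0 <= c by rewrite addr_ge0 ?normc_ge0.
pose t' := t / (2 * (c + 1)).
have t'0 : 0 < t' by rewrite divr_gt0 // mulr_gt0 // ltr_wpDl.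
have re : r < e by rewrite /r; lra.
have ue : normc (u - z) < e by clear -uz re r0; lra.
have [n1 H1] := sf v1 (lt_trans v1z re) t' t'0.
have [n2 H2] := sf v2 (lt_trans v2z re) t' t'0.
have [n3 H3] := sf u ue t' t'0.
pose n := (n1 + (n2 + n3))%N.
have {}H1 := H1 n (leq_addr _ _).
have {}H2 : normc (s v2 n - f v2) < t'.
  by apply: H2; exact: leq_trans (leq_addr n3 n2) (leq_addl n1 _).
have {}H3 : normc (s u n - f u) < t'.
  by apply: H3; exact: leq_trans (leq_addl n2 n3) (leq_addl n1 _).
have {partial} := partial n.
set X := _ - _; set Y := _ - _ * (v1 - u).
have -> : Y = X - ((s v1 n - f v1) - (s u n - f u)) * (v2 - u)
    + ((s v2 n - f v2) - (s u n - f u)) * (v1 - u) by rewrite /X /Y; ring.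
move=> HX; apply: le_trans (normcD _ _) _.
have := normcB X ((s v1 n - f v1 - (s u n - f u)) * (v2 - u)).
rewrite !Normc.normcM.
have b1 : normc (s v1 n - f v1 - (s u n - f u)) * normc (v2 - u) <=
    2 * t' * normc (v2 - u).
  by rewrite ler_wpM2r ?normc_ge0 //; have := normcB (s v1 n - f v1) (s u n - f u); lra.
have b2 : normc (s v2 n - f v2 - (s u n - f u)) * normc (v1 - u) <=
    2 * t' * normc (v1 - u).
  by rewrite ler_wpM2r ?normc_ge0 //; have := normcB (s v2 n - f v2) (s u n - f u); lra.
have b3 : 2 * t' * c <= t.
  have c1 : 0 < c + 1 by rewrite ltr_wpDl.
  have -> : 2 * t' * c = t * (c / (c + 1)) by rewrite /t'; field; exact: lt0r_neq0.
  by apply: ler_piMr; [exact: ltW | rewrite ler_pdivrMr // mul1r lerDl].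
have : 2 * t' * c = 2 * t' * normc (v1 - u) + 2 * t' * normc (v2 - u).
  by rewrite /c mulrDr.
clear -HX b1 b2 b3; lra.
Qed.

End SecondDifference.

Section UniformSecondDifference.
Context {R : realType}.
Implicit Types (f : R[i] -> R[i]) (z u v w : R[i]).

Lemma second_diff_bound_weaken f (d d' K K' : R) u : d' <= d -> K <= K' ->
  second_diff_bound f d K u -> second_diff_bound f d' K' u.
Proof.
move=> dd KK H v1 v2 h1 h2.
apply: le_trans (H v1 v2 (lt_le_trans h1 dd) (lt_le_trans h2 dd)) _.
by rewrite ler_wpM2r // !mulr_ge0 ?normc_ge0.
Qed.

Lemma normc_le_ReIm (x y : R) : normc (x +i* y) <= `|x| + `|y|.
Proof.
have -> : x +i* y = x%:C + 'i * y%:C by simpc.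
apply: le_trans (normcD _ _) _; rewrite Normc.normcM !normc_real.
by rewrite [normc 'i]/Normc.normc /= expr0n /= expr1n add0r sqrtr1 mul1r.
Qed.

Definition ellipse_gauge (a b : R) z :=
  (complex.Re z / a) ^+ 2 + (complex.Im z / b) ^+ 2.

(** Compactness: a pair (constant, radius) that works near a point is beaten by
    (n, 1 / (n + 1)) for n large, so finitely many points decide n. *)
Lemma ellipse_second_diff_bound f (a b : R) : 0 < a -> 0 < b ->
  (forall z, ellipse_gauge a b z <= 1 -> locally_second_diff f z) ->
  exists K d : R, [/\ 0 <= K, 0 < d &
    forall u, ellipse_gauge a b u <= 1 -> second_diff_bound f d K u].
Proof.
move=> a0 b0 loc.
pose S := (`[- a, a]%classic `*` `[- b, b]%classic) `&`
  [set q : R * R | ellipse_gauge a b (q.1 +i* q.2) <= 1].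
have cS : compact S.
  apply: compact_closedI.
    by apply: compact_setX; exact: segment_compact.
  pose g (q : R * R) := (q.1 / a) * (q.1 / a) + (q.2 / b) * (q.2 / b).
  have cg : continuous g.
    move=> q.
    have h1 : (fun p : R * R => p.1 / a) @ q --> q.1 / a.
      by apply: cvgMl; exact: cvg_fst.
    have h2 : (fun p : R * R => p.2 / b) @ q --> q.2 / b.
      by apply: cvgMl; exact: cvg_snd.
    exact: (cvgD (cvgM h1 h1) (cvgM h2 h2)).
  exact: (preimage_closed (in1W cg) (@closed_le R 1)).
move/compact_near_coveringP: cS.
move=> /(_ nat \oo (fun n q => second_diff_bound f n.+1%:R^-1 n%:R (q.1 +i* q.2))).
case.
- move=> [x y] [_ /= gxy]; have [K [d [d0 H]]] := loc _ gxy.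
  pose n0 := Num.bound (`|K| + d^-1).
  have n0P : `|K| + d^-1 < n0%:R.
    by apply: archi_boundP; rewrite addr_ge0 // invr_ge0 ltW.
  exists ([set q | normc ((q.1 +i* q.2) - (x +i* y)) < d], [set n | (n0 <= n)%N]).
    split => /=; last by exists n0.
    exists (ball x (d / 2), ball y (d / 2)).
      by split; apply: nbhsx_ballx; lra.
    move=> [x' y'] [/= hx hy].
    apply: le_lt_trans (normc_le_ReIm _ _) _.
    by rewrite /ball /= distrC in hx; rewrite /ball /= distrC in hy; lra.
  move=> [[x' y'] n] [/= hd nn].
  have nn' : n0%:R <= n%:R :> R by rewrite ler_nat.
  apply: (second_diff_bound_weaken _ _ _ _ _ _ _ _ (H _ hd)).
    rewrite -[leRHS]invrK lef_pV2 ?posrE ?invr_gt0 //.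
    have := normr_ge0 K; rewrite -natr1; lra.
  have : 0 < d^-1 by rewrite invr_gt0.
  have := ler_norm K; lra.
move=> n _ H; exists n%:R, n.+1%:R^-1; split; rewrite ?invr_gt0 //.
case=> x y gxy; apply: (H n (leqnn n) (x, y)); split => //=.
have bnd (s c : R) : 0 < c -> (s / c) ^+ 2 <= 1 -> s \in `[- c, c].
  move=> c0 h; rewrite in_itv /=.
  have : `|s / c| <= 1.
    by rewrite -(@expr_le1 _ 2) // -normrX ger0_norm ?sqr_ge0.
  by rewrite normrM normfV (gtr0_norm c0) ler_pdivrMr // mul1r ler_norml.
move: gxy; rewrite /ellipse_gauge /= => gxy.
have h1 := sqr_ge0 (x / a); have h2 := sqr_ge0 (y / b).
by split; apply: bnd => //; clear -gxy h1 h2; lra.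
Qed.

End UniformSecondDifference.

(** * Cauchy formula for fine polygons *)

Section DiscreteCauchy.
Context {R : realType}.
Implicit Types (f : R[i] -> R[i]) (w : nat -> R[i]) (y : R[i]).

(** The three points entering the second difference are U = y + t (u - y), its
    displacement towards [y] and its displacement along the polygon; the bound
    says that the two slopes of [f] at U nearly agree. *)
Lemma homothety_step f (K d s t : R) (u v y : R[i]) :
  0 <= s -> 0 < t -> u != y ->
  second_diff_bound f d K (y + t%:C * (u - y)) ->
  normc (t%:C * (v - u)) < d -> normc (s%:C * (u - y)) < d -> t <= 1 -> 0 <= K ->
  normc ((f (y + t%:C * (u - y)) - f (y + (t - s)%:C * (u - y))) * ((v - u) / (u - y))
    - (s / t)%:C * (f (y + t%:C * (v - y)) - f (y + t%:C * (u - y))))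
  <= K * (s * normc (v - u) * (s * normc (u - y) + normc (v - u))).
Proof.
move=> s0 t0 uy H hv hu t1 K0; set U := y + t%:C * (u - y) in H *.
have e1 : y + (t - s)%:C * (u - y) - U = - (s%:C * (u - y)).
  by rewrite /U rmorphB /=; ring.
have e2 : y + t%:C * (v - y) - U = t%:C * (v - u) by rewrite /U; ring.
have := H (y + (t - s)%:C * (u - y)) (y + t%:C * (v - y)).
rewrite e1 e2 normc_opp => /(_ hu hv).
have -> : y + (t - s)%:C * (u - y) - (y + t%:C * (v - y)) =
    - (s%:C * (u - y) + t%:C * (v - u)) by rewrite rmorphB /=; ring.
rewrite normc_opp; set X := _ - _.
have uy' : u - y != 0 by rewrite subr_eq0.
have tC : t%:C != 0 :> R[i] by rewrite eq_complex /= gt_eqF.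
move=> HX; set Y := normc _.
have YX : Y * (t * normc (u - y)) = normc X.
  have -> : t * normc (u - y) = normc (t%:C * (u - y)).
    by rewrite Normc.normcM normc_real gtr0_norm.
  rewrite /Y -Normc.normcM -normc_opp; congr normc.
  rewrite /X (_ : (s / t)%:C = s%:C / t%:C); last by rewrite rmorphM fmorphV.
  by field; rewrite uy' tC.
have tuy : 0 < t * normc (u - y) by rewrite mulr_gt0 ?normc_gt0.
rewrite -(ler_pM2r tuy) YX; apply: le_trans HX _.
rewrite !Normc.normcM !normc_real (ger0_norm s0) (gtr0_norm t0).
set a := normc (u - y); set b := normc (v - u).
have a0 : 0 <= a by exact: normc_ge0.
have b0 : 0 <= b by exact: normc_ge0.
have -> : K * (s * b * (s * a + b)) * (t * a) =
  K * (s * a * (t * b) * (s * a + b)) by ring.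
rewrite ler_wpM2l // ler_wpM2l //; first by rewrite !mulr_ge0 // ltW.
apply: le_trans (normcD _ _) _.
rewrite !Normc.normcM !normc_real (ger0_norm s0) (gtr0_norm t0).
by rewrite lerD2l -[leRHS]mul1r ler_wpM2r.
Qed.

(** The discrete counterpart of the classical argument that the Cauchy integral of
    f(y + t (w - y)) / (w - y) does not depend on t: its derivative in t is the
    integral of an exact derivative along the closed curve. *)
Lemma polygon_cauchy f (K d : R) (N : nat) w y :
  0 <= K -> 0 < d -> w N = w 0%N ->
  (forall j, (j < N)%N -> w j != y) ->
  (forall j, (j < N)%N -> normc (w j.+1 - w j) < d) ->
  (forall j (t : R), (j < N)%N -> 0 <= t <= 1 ->
     second_diff_bound f d K (y + t%:C * (w j - y))) ->
  normc (\sum_(j < N) (f (w j) - f y) * ((w j.+1 - w j) / (w j - y))) <=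
  K * \sum_(j < N) normc (w j.+1 - w j) ^+ 2.
Proof.
move=> K0 d0 wN wy wd H.
pose D := \sum_(j < N) normc (w j - y).
have D0 : 0 <= D by rewrite sumr_ge0 // => j _; exact: normc_ge0.
have wD (j : 'I_N) : normc (w j - y) <= D.
  by rewrite /D (bigD1 j) //= lerDl sumr_ge0 // => i _; exact: normc_ge0.
pose L := \sum_(j < N) normc (w j.+1 - w j).
have L0 : 0 <= L by rewrite sumr_ge0 // => j _; exact: normc_ge0.
pose Q := \sum_(j < N) normc (w j.+1 - w j) ^+ 2.
pose I (t : R) := \sum_(j < N) f (y + t%:C * (w j - y)) * ((w j.+1 - w j) / (w j - y)).
(* Summed around the polygon, the differences of [f] between consecutive vertices
   cancel; only the second-order errors remain. *)
have step (s t : R) : 0 <= s -> 0 < t <= 1 -> s * D < d ->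
    normc (I t - I (t - s)) <= K * s * (s * D * L + Q).
  move=> s0 /andP[t0 t1] sD.
  have -> : I t - I (t - s) = \sum_(j < N)
     ((f (y + t%:C * (w j - y)) - f (y + (t - s)%:C * (w j - y)))
       * ((w j.+1 - w j) / (w j - y))
     - (s / t)%:C * (f (y + t%:C * (w j.+1 - y)) - f (y + t%:C * (w j - y)))).
    rewrite sumrB -mulr_sumr -[X in _ - _ * X](big_mkord predT
      (fun j => f (y + t%:C * (w j.+1 - y)) - f (y + t%:C * (w j - y)))).
    rewrite telescope_sumr // wN subrr mulr0 subr0 /I -sumrB.
    by apply: eq_bigr => j _; rewrite [RHS]mulrBl.
  apply: le_trans (normc_sum _ _ _ _) _.
  have -> : K * s * (s * D * L + Q) = \sum_(j < N)
      K * (s * normc (w j.+1 - w j) * (s * D + normc (w j.+1 - w j))).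
    rewrite /L /Q mulrDr !mulr_sumr -big_split /=; apply: eq_bigr => j _.
    by ring.
  apply: ler_sum => j _.
  apply: le_trans (homothety_step _ _ _ _ _ _ _ _ s0 t0 _ _ _ _ t1 K0) _.
  - exact: wy.
  - by apply: H => //; rewrite ltW.
  - rewrite Normc.normcM normc_real gtr0_norm //; apply: le_lt_trans (wd j (ltn_ord j)).
    by rewrite -[leRHS]mul1r ler_wpM2r ?normc_ge0.
  - rewrite Normc.normcM normc_real ger0_norm //; apply: le_lt_trans sD.
    by rewrite ler_wpM2l.
  - rewrite ler_wpM2l // ler_wpM2l ?mulr_ge0 ?normc_ge0 // lerD2r.
    by rewrite ler_wpM2l.
have I1 : \sum_(j < N) (f (w j) - f y) * ((w j.+1 - w j) / (w j - y)) = I 1 - I 0.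
  rewrite /I -sumrB; apply: eq_bigr => j _.
  by rewrite mul1r mul0r addr0 [y + _]addrC subrK [LHS]mulrBl.
rewrite I1 -/Q; apply/ler_addgt0Pr => t t0.
pose n := (Num.bound ((K * D * L) / t + D / d)).+1.
have nP : (K * D * L) / t + D / d < n%:R.
  apply: lt_le_trans (archi_boundP _) _; last by rewrite ler_nat.
  by rewrite addr_ge0 // divr_ge0 ?mulr_ge0 // ltW.
have n0 : 0 < n%:R :> R by rewrite ltr0n.
have ntD : n%:R^-1 * D < d.
  rewrite mulrC ltr_pdivrMr // mulrC -ltr_pdivrMr //; apply: le_lt_trans nP.
  by rewrite lerDr divr_ge0 ?mulr_ge0 // ltW.
have ntL : K * (n%:R^-1 * D * L) <= t.
  have -> : K * (n%:R^-1 * D * L) = K * D * L / n%:R by ring.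
  rewrite ler_pdivrMr // [leRHS]mulrC -ler_pdivrMr //; apply: le_trans (ltW nP).
  by rewrite lerDl divr_ge0 // ltW.
(* Contracting the polygon to [y] in [n] equal steps leaves, besides the main
   term, an error of order 1 / n. *)
have walk m : (m <= n)%N -> normc (I (m%:R / n%:R) - I 0) <=
    m%:R * (K * n%:R^-1 * (n%:R^-1 * D * L + Q)).
  elim: m => [_|m IH mn]; first by rewrite !mul0r subrr Normc.normc0.
  apply: le_trans (normc_dist _ (I (m%:R / n%:R)) _) _.
  rewrite -[m.+1%:R]natr1; set Bd := _ * (_ + Q).
  have -> : (m%:R + 1) * Bd = Bd + m%:R * Bd by ring.
  apply: lerD; last exact/IH/ltnW.
  have -> : I (m%:R / n%:R) = I ((m%:R + 1) / n%:R - n%:R^-1).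
    by congr I; field; rewrite gt_eqF.
  apply: step => //.
  rewrite natr1 divr_gt0 ?ltr0n //= ler_pdivrMr // mul1r ler_nat; exact: mn.
have := walk n (leqnn n); rewrite divff ?gt_eqF // => /le_trans; apply.
have -> : n%:R * (K * n%:R^-1 * (n%:R^-1 * D * L + Q)) =
    K * (n%:R^-1 * D * L) + K * Q by field; rewrite gt_eqF.
by rewrite addrC lerD2l.
Qed.

End DiscreteCauchy.

(** * The Joukowski map and the Cauchy kernel of the ellipse *)

Section JoukowskiKernel.
Context {R : realType}.
Implicit Types (x u w s : R[i]).

(** Powers below N being different from 1 is what makes the means of the low
    powers over the N points vanish exactly. *)
Lemma fine_root_of_unity (e : R) : 0 < e -> exists (N : nat) (w : R[i]),
  [/\ (0 < N)%N, N%:R^-1 < e, w ^+ N = 1,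
      forall k, (0 < k < N)%N -> w ^+ k != 1 & normc w = 1 /\ normc (w - 1) < e].
Proof.
move=> e0.
have [d d0 dP] : exists2 d : R, 0 < d & forall t : R, `|t| < d ->
    `|cos t - 1| < e / 2 /\ `|sin t| < e / 2.
  have e20 : 0 < e / 2 by lra.
  have /cvgrPdist_lt/(_ _ e20) hc := @continuous_cos R 0.
  have /cvgrPdist_lt/(_ _ e20) hs := @continuous_sin R 0.
  have [d /= d0 dP] := (nbhs_ballP _ _).1 (filterI hc hs).
  exists d => // t td; have [|] := dP t; first by rewrite /ball /= sub0r normrN.
  by rewrite cos0 sin0 sub0r normrN distrC.
pose N := (Num.bound (e^-1 + 2 * pi / d)).+1.
have NP : e^-1 + 2 * pi / d < N%:R.
  apply: lt_le_trans (archi_boundP _) _; last by rewrite ler_nat.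
  by rewrite addr_ge0 ?invr_ge0 ?(ltW e0) // divr_ge0 ?mulr_ge0 ?pi_ge0 // ltW.
have N0 : 0 < N%:R :> R by rewrite ltr0n.
pose th : R := 2 * pi / N%:R.
have powE k : (cos th +i* sin th) ^+ k = cos (k%:R * th) +i* sin (k%:R * th).
  elim: k => [|k IH]; first by rewrite expr0 mul0r cos0 sin0.
  rewrite exprS IH -natr1 mulrDl mul1r [_ + th]addrC cosD sinD.
  by apply/eqP; rewrite eq_complex /= eqxx /= addrC.
have NthE : N%:R * th = 2 * pi by rewrite /th mulrC divfK // gt_eqF.
exists N, (cos th +i* sin th); split => //.
- rewrite -[ltRHS]invrK ltf_pV2 ?posrE ?invr_gt0 //; apply: le_lt_trans NP.
  by rewrite lerDl divr_ge0 ?mulr_ge0 ?pi_ge0 // ltW.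
- by rewrite powE NthE mulr_natl cos2pi sin2pi.
- move=> k /andP[k0 kN]; rewrite powE eq_complex /= negb_and; apply/orP; left.
  have kth0 : 0 < k%:R * th / 2 < pi.
    have -> : k%:R * th / 2 = pi * (k%:R / N%:R) by rewrite /th; field; rewrite gt_eqF.
    rewrite mulr_gt0 ?pi_gt0 ?divr_gt0 ?ltr0n //=.
    by rewrite -[ltRHS]mulr1 ltr_pM2l ?pi_gt0 // ltr_pdivrMr // mul1r ltr_nat.
  have s0 := sin_gt0_pi kth0.
  have -> : k%:R * th = (k%:R * th / 2) *+ 2 by rewrite mulr2n; field.
  rewrite cos_mulr2n cos2sin2 mulr2n; apply/eqP => h.
  by have := exprn_gt0 2 s0; clear -h; lra.
split; first by rewrite /Normc.normc cos2Dsin2 sqrtr1.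
have -> : cos th +i* sin th - 1 = (cos th - 1) +i* sin th.
  by apply/eqP; rewrite eq_complex /= subr0 !eqxx.
apply: le_lt_trans (normc_le_ReIm _ _) _.
have [|] := dP th; last by lra.
rewrite ger0_norm /th; last by rewrite divr_ge0 ?mulr_ge0 ?pi_ge0 // ltW.
rewrite ltr_pdivrMr // [ltRHS]mulrC -ltr_pdivrMr //; apply: le_lt_trans NP.
by rewrite lerDr invr_ge0 ltW.
Qed.

(** It maps the circles centred at the origin onto the ellipses with foci -1 and
    1, and the unit circle onto the segment between the foci. *)
Definition joukowski u : R[i] := (u + u^-1) / 2.

(** The form u J'(u) / (J(u) - J(x)) of the Cauchy kernel, in partial
    fractions. *)
Definition cauchy_kernel u x : R[i] := (1 - x / u)^-1 + (1 - (x * u)^-1)^-1 - 1.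

(** The coefficient of u ^- k in the expansion of the kernel for large u.  For k
    positive it is twice the Chebyshev polynomial of degree k at J(x). *)
Definition laurent_basis (k : nat) x : R[i] :=
  if k is 0%N then 1 else x ^+ k + x ^- k.

(** For the step from u to u w of the polygon the chord replaces the tangent; the
    second term of the bracket is the price. *)
Lemma joukowski_kernel u x w : u != 0 -> x != 0 -> w != 0 -> u - x != 0 ->
  x * u - 1 != 0 ->
  (joukowski (u * w) - joukowski u) / (joukowski u - joukowski x) =
  (w - 1) * (cauchy_kernel u x +
             (1 - w^-1) / (u * ((u - x) * (1 - (x * u)^-1)))).
Proof.
move=> u0 x0 w0 ux xu; rewrite /joukowski /cauchy_kernel.
field; rewrite u0 x0 w0 ux xu /=.
have -> : (u * u + 1) * x + - (x * x + 1) * u = (u - x) * (x * u - 1) by ring.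
by rewrite mulf_neq0.
Qed.

Lemma geometric_tail s m : 1 - s != 0 ->
  (1 - s)^-1 = \sum_(k < m) s ^+ k + s ^+ m / (1 - s).
Proof.
move=> s1; elim: m => [|m IH]; first by rewrite big_ord0 expr0 add0r div1r.
by rewrite big_ord_recr /= [LHS]IH -addrA; congr (_ + _); rewrite exprS; field.
Qed.

Lemma geometric_tail_le s m (r : R) : 2 <= r -> normc s = r^-1 ->
  normc (s ^+ m / (1 - s)) <= 2 * r ^- m.
Proof.
move=> r2 sr; have r0 : 0 < r by lra.
have rV : r^-1 <= 2^-1 by rewrite lef_pV2 ?posrE //; lra.
have h : 2^-1 <= normc (1 - s).
  have := normc_dist 1 s 0; rewrite !subr0 Normc.normc1 sr; lra.
have h0 : 0 < normc (1 - s) by apply: lt_le_trans h; lra.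
rewrite Normc.normcM Normc.normcV normcX sr exprVn mulrC ler_wpM2r //.
  by rewrite invr_ge0 exprn_ge0 // ltW.
by rewrite -[leRHS]invrK lef_pV2 ?posrE //; lra.
Qed.

(** The kernel is a sum of two geometric series, of ratios x / u and 1 / (x u),
    whose k-th terms add up to the k-th term of the Laurent expansion. *)
Lemma cauchy_kernel_tail u x m (r : R) : 2 <= r -> normc u = r -> normc x = 1 ->
  (0 < m)%N ->
  normc (cauchy_kernel u x - \sum_(k < m) laurent_basis k x * u ^- k)
    <= 4 * r ^- m.
Proof.
move=> r2 ur x1; case: m => // m _.
have s1 s : normc s = r^-1 -> 1 - s != 0.
  move=> sr; rewrite subr_eq0; apply: contraTneq r2 => s1.
  by rewrite -ltNge -[r]invrK -sr -s1 Normc.normc1 invr1; lra.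
have sr : normc (x / u) = r^-1 by rewrite Normc.normcM Normc.normcV x1 ur mul1r.
have tr : normc (x * u)^-1 = r^-1 by rewrite Normc.normcV Normc.normcM x1 ur mul1r.
have -> : cauchy_kernel u x - \sum_(k < m.+1) laurent_basis k x * u ^- k =
   (x / u) ^+ m.+1 / (1 - x / u) + (x * u)^-1 ^+ m.+1 / (1 - (x * u)^-1).
  rewrite /cauchy_kernel [X in X + _ - 1 - _](geometric_tail _ m.+1 (s1 _ sr)).
  rewrite [X in _ + X - 1 - _](geometric_tail _ m.+1 (s1 _ tr)).
  set A := (x / u) ^+ m.+1 / _; set B := (x * u)^-1 ^+ m.+1 / _.
  rewrite !big_ord_recl !expr0 /= invr1 mulr1.
  have -> : \sum_(i < m) laurent_basis (lift ord0 i) x * u ^- lift ord0 i =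
     \sum_(i < m) (x / u) ^+ lift ord0 i + \sum_(i < m) (x * u)^-1 ^+ lift ord0 i.
    rewrite -big_split /=; apply: eq_bigr => i _.
    by rewrite /laurent_basis /= mulrDl exprMn !exprVn exprMn invfM.
  ring.
apply: le_trans (normcD _ _) _.
have := geometric_tail_le _ m.+1 _ r2 sr; have := geometric_tail_le _ m.+1 _ r2 tr.
lra.
Qed.

End JoukowskiKernel.

(** * Bernstein ellipses *)

Section EllipseGeometry.
Context {R : realType}.
Implicit Types (u x z : R[i]).

Lemma normc_sqr (a b : R) : normc (a +i* b) ^+ 2 = a ^+ 2 + b ^+ 2.
Proof. by rewrite sqr_sqrtr // addr_ge0 ?sqr_ge0. Qed.

Lemma joukowskiE (a b r : R) : 0 < r -> normc (a +i* b) = r ->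
  joukowski (a +i* b) = ((r + r^-1) / 2 * (a / r)) +i* ((r - r^-1) / 2 * (b / r)).
Proof.
move=> r0 nr; rewrite /joukowski.
have n2 : a ^+ 2 + b ^+ 2 = r ^+ 2 by rewrite -nr normc_sqr.
have -> : (a +i* b)^-1 = (a / r ^+ 2) -i* (b / r ^+ 2) by rewrite -n2.
have -> : (2 : R[i])^-1 = (2^-1)%:C by rewrite fmorphV rmorph_nat.
apply/eqP; rewrite eq_complex /= !mulr0 subr0 add0r; apply/andP.
by split; apply/eqP; field; rewrite gt_eqF.
Qed.

Definition semimajor (r : R) := (r + r^-1) / 2.
Definition semiminor (r : R) := (r - r^-1) / 2.

Lemma semiminor_gt0 (r : R) : 1 < r -> 0 < semiminor r.
Proof.
move=> r1; have : r^-1 < 1 by rewrite invf_lt1 //; lra.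
by rewrite /semiminor; lra.
Qed.

Lemma semimajor_ge1 (r : R) : 0 < r -> 1 <= semimajor r.
Proof.
move=> r0; have : 0 <= (r - 1) ^+ 2 / r by rewrite divr_ge0 ?sqr_ge0 // ltW.
have -> : (r - 1) ^+ 2 / r = r + r^-1 - 2 by field; rewrite gt_eqF.
by rewrite /semimajor; lra.
Qed.

Lemma joukowski_circle (r : R) u : 1 < r -> normc u = r ->
  ellipse_gauge (semimajor r) (semiminor r) (joukowski u) = 1.
Proof.
case: u => a b r1 nr; have r0 : 0 < r by lra.
rewrite (joukowskiE _ _ _ r0 nr) /ellipse_gauge /=.
have n2 : a ^+ 2 + b ^+ 2 = r ^+ 2 by rewrite -nr normc_sqr.
have s1 := semimajor_ge1 _ r0; have s2 := semiminor_gt0 _ r1.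
have m1 : semimajor r != 0 by rewrite gt_eqF //; lra.
rewrite -/(semimajor r) -/(semiminor r).
have cancel (m t : R) : m != 0 -> m * t / m = t by move=> m0; rewrite mulrAC divff ?mul1r.
rewrite !cancel ?(gt_eqF s2) //.
by rewrite !exprMn -mulrDl n2 exprVn divff // expf_neq0 // gt_eqF.
Qed.

Lemma joukowski_unit_circle x : normc x = 1 ->
  exists2 y : R, joukowski x = y%:C & y ^+ 2 <= 1.
Proof.
case: x => a b n1; exists a.
  by rewrite (joukowskiE _ _ _ ltr01 n1) invr1 subrr !mul0r mulr1 -mulr2n divff
    ?mul1r ?pnatr_eq0.
have : a ^+ 2 + b ^+ 2 = 1 by rewrite -normc_sqr n1 expr1n.
by have := sqr_ge0 b; lra.
Qed.

Lemma joukowski_surj (y : R) : -1 <= y <= 1 ->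
  exists2 x, normc x = 1 & joukowski x = y%:C.
Proof.
move=> y1; have y2 : 0 <= 1 - y ^+ 2.
  by rewrite subr_ge0 -real_normK ?num_real // expr_le1 // ler_norml.
have n1 : normc (y +i* Num.sqrt (1 - y ^+ 2)) = 1.
  by rewrite /Normc.normc sqr_sqrtr // addrC subrK sqrtr1.
exists (y +i* Num.sqrt (1 - y ^+ 2)) => //.
by rewrite (joukowskiE _ _ _ ltr01 n1) invr1 subrr !mul0r mulr1 -mulr2n divff
    ?mul1r ?pnatr_eq0.
Qed.

Lemma sqr_convex (s t l : R) : 0 <= l <= 1 ->
  (s + l * (t - s)) ^+ 2 <= (1 - l) * s ^+ 2 + l * t ^+ 2.
Proof.
move=> /andP[l0 l1]; rewrite -subr_ge0.
have -> : (1 - l) * s ^+ 2 + l * t ^+ 2 - (s + l * (t - s)) ^+ 2 =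
   l * (1 - l) * (s - t) ^+ 2 by ring.
by apply: mulr_ge0 (sqr_ge0 _); apply: mulr_ge0; rewrite ?subr_ge0.
Qed.

Lemma ellipse_gauge_segment (a b l : R) z u : 0 <= l <= 1 ->
  ellipse_gauge a b z <= 1 -> ellipse_gauge a b u <= 1 ->
  ellipse_gauge a b (z + l%:C * (u - z)) <= 1.
Proof.
case: z => z1 z2; case: u => u1 u2 l01; rewrite /ellipse_gauge /= !mul0r subr0 addr0.
have -> : (z1 + l * (u1 - z1)) / a = z1 / a + l * (u1 / a - z1 / a) by ring.
have -> : (z2 + l * (u2 - z2)) / b = z2 / b + l * (u2 / b - z2 / b) by ring.
have := sqr_convex (z1 / a) (u1 / a) _ l01.
have := sqr_convex (z2 / b) (u2 / b) _ l01.
move/andP: l01 => [l0 l1]; have l1' : 0 <= 1 - l by lra.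
set A := (z1 / a) ^+ 2; set B := (z2 / b) ^+ 2.
set A' := (u1 / a) ^+ 2; set B' := (u2 / b) ^+ 2.
move=> h1 h2 h3 h4; have := ler_wpM2l l1' h3; have := ler_wpM2l l0 h4.
by rewrite !mulr1 !mulrDr; clear -h1 h2; lra.
Qed.

(** Both semi-axes increase strictly with the parameter. *)
Lemma closed_ellipse_sub (r rho : R) z : 1 < r -> r < rho ->
  ellipse_gauge (semimajor r) (semiminor r) z <= 1 -> bernstein_unit rho z.
Proof.
move=> r1 rrho; have r0 : 0 < r by lra.
have rho1 : 1 < rho by lra.
have VV : rho^-1 < r^-1 by rewrite ltf_pV2 ?posrE //; lra.
have rV : r^-1 < 1 by rewrite invf_lt1.
have a1 := semimajor_ge1 _ r0; have b0 := semiminor_gt0 _ r1.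
have a1' : 1 <= semimajor rho by apply: semimajor_ge1; lra.
have b0' := semiminor_gt0 _ rho1.
have aa : semimajor r < semimajor rho.
  have : 0 < (rho - r) * (1 - r^-1 * rho^-1).
    rewrite mulr_gt0 ?subr_gt0 // -[ltRHS]mul1r ltr_pM ?invr_ge0 //; lra.
  have -> : (rho - r) * (1 - r^-1 * rho^-1) = (rho + rho^-1) - (r + r^-1).
    by field; rewrite !gt_eqF //; lra.
  by rewrite /semimajor; lra.
have bb : semiminor r < semiminor rho by rewrite /semiminor; lra.
move=> g1; exists (semimajor rho), (semiminor rho).
split; rewrite /semimajor /semiminor -/(semimajor rho) -/(semiminor rho) //; first lra.
- by rewrite /semimajor /semiminor; field; rewrite gt_eqF //; lra.
- by rewrite /semimajor /semiminor; lra.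
move: g1; rewrite /ellipse_gauge.
have shrink (s a a' : R) : 0 < a -> a < a' ->
    (s / a') ^+ 2 <= (s / a) ^+ 2 /\ ((s / a') ^+ 2 = (s / a) ^+ 2 -> s = 0).
  move=> p pp; have p' : 0 < a' by lra.
  have V : a' ^- 2 < a ^- 2 by rewrite ltf_pV2 ?posrE ?exprn_gt0 // ltrXn2r //; lra.
  rewrite !exprMn !exprVn; split; first by rewrite ler_wpM2l ?sqr_ge0 // ltW.
  move=> E; apply/eqP; rewrite -sqrf_eq0; apply/eqP.
  have : s ^+ 2 * (a ^- 2 - a' ^- 2) = 0 by rewrite mulrBr E subrr.
  by move/eqP; rewrite mulf_eq0 [X in _ || X]gt_eqF ?subr_gt0 // orbF => /eqP.
case: z => x y /=.
have a0 : 0 < semimajor r by lra.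
have [hx1 hx2] := shrink x _ _ a0 aa; have [hy1 hy2] := shrink y _ _ b0 bb.
move=> g1; rewrite lt_neqAle; apply/andP; split; last by clear -hx1 hy1 g1; lra.
apply/eqP => g2.
have ex : (x / semimajor rho) ^+ 2 = (x / semimajor r) ^+ 2 by clear -hx1 hy1 g1 g2; lra.
have ey : (y / semiminor rho) ^+ 2 = (y / semiminor r) ^+ 2 by clear -hx1 hy1 g1 g2; lra.
by move: g2; rewrite (hx2 ex) (hy2 ey) !mul0r expr0n /= addr0; clear; lra.
Qed.

End EllipseGeometry.

(** * Approximation of bounded analytic functions in an ellipse *)

Section BernsteinApproximation.
Context {R : realType}.
Implicit Types (u x z : R[i]).

Lemma root_power_sum N (w : R[i]) k : w ^+ N = 1 -> w ^+ k != 1 ->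
  \sum_(j < N) w ^- k ^+ j = 0.
Proof.
move=> wN wk.
have v1 : w ^- k - 1 != 0 by rewrite subr_eq0 invr_eq1.
apply: (mulfI v1); rewrite mulr0 -subrX1 exprVn -exprM mulnC exprM wN.
by rewrite expr1n invr1 subrr.
Qed.

(** The mean of the kernel over the N points is nearly 1: its first N Laurent terms
    have mean zero, except the constant one. *)
Lemma cauchy_kernel_sum N (w x : R[i]) (r : R) : 2 <= r -> normc w = 1 ->
  normc x = 1 -> (0 < N)%N -> w ^+ N = 1 ->
  (forall k, (0 < k < N)%N -> w ^+ k != 1) ->
  normc (\sum_(j < N) cauchy_kernel (r%:C * w ^+ j) x - N%:R) <= N%:R * (4 * r ^- N).
Proof.
move=> r2 w1 x1 N0 wN wk; have r0 : 0 < r by lra.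
have nu j : normc (r%:C * w ^+ j) = r.
  by rewrite Normc.normcM normc_real normcX w1 expr1n mulr1 gtr0_norm.
have main : \sum_(j < N) \sum_(k < N) laurent_basis k x * (r%:C * w ^+ j) ^- k = N%:R.
  rewrite exchange_big /= -(prednK N0) big_ord_recl /= [X in _ + X]big1 => [|k _].
    rewrite addr0 (eq_bigr (fun=> 1)) ?sumr_const ?card_ord // => j _.
    by rewrite expr0 invr1 mulr1.
  set l := bump _ _.
  transitivity (laurent_basis l x * r%:C ^- l * \sum_(j < N.-1.+1) (w ^- l) ^+ j).
    rewrite mulr_sumr; apply: eq_bigr => j _.
    by rewrite exprMn invfM mulrA; congr (_ * _); rewrite -exprM mulnC exprM exprVn.
  rewrite (prednK N0) root_power_sum ?mulr0 // wk //=.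
  by rewrite /l /bump /= -[ltnRHS](prednK N0) ltnS.
rewrite -{1}main -sumrB; apply: le_trans (normc_sum _ _ _ _) _.
rewrite mulr_natl -[X in _ <= _ *+ X](card_ord N) -sumr_const.
by apply: ler_sum => j _; exact: cauchy_kernel_tail.
Qed.

Lemma kernel_error_le u x w (r : R) : 2 <= r -> normc u = r -> normc x = 1 ->
  normc w = 1 ->
  normc ((1 - w^-1) / (u * ((u - x) * (1 - (x * u)^-1)))) <= normc (w - 1).
Proof.
move=> r2 ur x1 w1; have w0 : w != 0 by rewrite -normc_gt0 w1.
have -> : 1 - w^-1 = (w - 1) / w by field.
rewrite !Normc.normcM !Normc.normcV !Normc.normcM w1 invr1 mulr1 ur.
rewrite -[leRHS]mulr1 ler_wpM2l ?normc_ge0 //.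
have h1 : 1 <= normc (u - x).
  by have := normc_dist u x 0; rewrite !subr0 ur x1; clear -r2; lra.
have h2 : 2^-1 <= normc (1 - (x * u)^-1).
  have := normc_dist 1 (x * u)^-1 0.
  rewrite !subr0 Normc.normc1 Normc.normcV Normc.normcM ur x1 mul1r.
  have : r^-1 <= 2^-1 by rewrite lef_pV2 ?posrE //; lra.
  by clear; lra.
have h3 : 1 <= r * (normc (u - x) * normc (1 - (x * u)^-1)).
  have : 2^-1 <= normc (u - x) * normc (1 - (x * u)^-1).
    by rewrite -[leLHS]mul1r ler_pM // invr_ge0.
  by move: (_ * normc _) => t ht; have := ler_wpM2l (ltac:(lra) : 0 <= r) ht; lra.
by rewrite invf_le1 // (lt_le_trans _ h3).
Qed.

(** Cauchy's formula on the polygon with vertices J(r w ^ j), with the kernel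
    truncated after M terms.  The coefficients do not depend on the point x; the
    arbitrarily small [eta] pays for the discretisation. *)
Lemma laurent_approx (f : R[i] -> R[i]) (V r eta : R) M : 2 <= r -> (0 < M)%N ->
  0 < eta ->
  (forall z, ellipse_gauge (semimajor r) (semiminor r) z <= 1 ->
     normc (f z) <= V /\ locally_second_diff f z) ->
  exists b : nat -> R[i], forall x, normc x = 1 ->
    normc (f (joukowski x) - \sum_(k < M) laurent_basis k x * b k)
      <= 4 * V * r ^- M + eta.
Proof.
move=> r2 M0 eta0 H; have r0 : 0 < r by lra.
have r1 : 1 < r by lra.
have a1 := semimajor_ge1 _ r0; have b0 := semiminor_gt0 _ r1.
have a0 : 0 < semimajor r by lra.
have [K [d [K0 d0 Hd]]] := ellipse_second_diff_bound f _ _ a0 b0 (fun z gz => (H z gz).2).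
have inx x : normc x = 1 -> ellipse_gauge (semimajor r) (semiminor r) (joukowski x) <= 1.
  move=> x1; have [y -> y2] := joukowski_unit_circle _ x1.
  rewrite /ellipse_gauge /= mul0r expr0n addr0 exprMn exprVn.
  rewrite ler_pdivrMr ?exprn_gt0 // mul1r; apply: le_trans y2 _.
  by rewrite exprn_ege1.
have V0 : 0 <= V by apply: le_trans (normc_ge0 _) (H _ (inx 1 (Normc.normc1 _))).1.
(* [c * e] bounds the total error of the discretisation, whose three sources are
   the polygon, the rotated numerator of the kernel, and the mean of the kernel. *)
pose c := K * r ^+ 2 + 6 * V + 1.
have c0 : 0 < c by rewrite /c; have := mulr_ge0 K0 (sqr_ge0 r); lra.
pose e := Num.min (d / r) (Num.min (eta / c) 1).
have e0 : 0 < e by rewrite !lt_min !divr_gt0 //=.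
have [N [w [N0 Ne wN wk [w1 we]]]] := fine_root_of_unity e e0.
have [ed ee e1] : [/\ e <= d / r, e <= eta / c & e <= 1].
  by rewrite /e !ge_min !lexx ?orbT.
have w0 : w != 0 by rewrite -normc_gt0 w1.
pose u j := r%:C * w ^+ j.
have nu j : normc (u j) = r.
  by rewrite Normc.normcM normc_real normcX w1 expr1n mulr1 gtr0_norm.
have inu j : ellipse_gauge (semimajor r) (semiminor r) (joukowski (u j)) <= 1.
  by rewrite joukowski_circle.
pose g j := f (joukowski (u j)).
have gV j : normc (g j) <= V by exact: (H _ (inu j)).1.
have Nr : 0 < N%:R :> R by rewrite ltr0n.
have NC : N%:R != 0 :> R[i] by rewrite pnatr_eq0 -lt0n.
exists (fun k => N%:R^-1 * \sum_(j < N) g j * u j ^- k) => x x1.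
set y := joukowski x.
have fyV : normc (f y) <= V by exact: (H _ (inx x x1)).1.
have u0 j : u j != 0 by rewrite -normc_gt0 nu.
have x0 : x != 0 by rewrite -normc_gt0 x1.
have ux j : u j - x != 0.
  rewrite -normc_gt0; have := normc_dist (u j) x 0; rewrite !subr0 nu x1; lra.
have xu j : x * u j - 1 != 0.
  rewrite -normc_gt0; have := normc_dist (x * u j) 1 0.
  by rewrite !subr0 Normc.normcM nu x1 Normc.normc1; lra.
have wsub1 : w - 1 != 0.
  rewrite subr_eq0; have N1 : (1 < N)%N.
    rewrite ltn_neqAle N0 andbT; apply: contraTneq Ne => <-.
    by rewrite invr1 -leNgt.
  by have := wk 1%N N1; rewrite expr1.
pose del := normc (w - 1); have del0 : 0 < del by rewrite normc_gt0.
have uS j : u j.+1 = u j * w by rewrite /u exprSr mulrA.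
have uN : u N = u 0%N by rewrite /u wN expr0.
have kersum : normc (\sum_(j < N) cauchy_kernel (u j) x - N%:R) <= N%:R * (4 * r ^- N).
  exact: cauchy_kernel_sum.
clearbody u.
pose J j := joukowski (u j).
have Jdiff j : J j.+1 - J j = (w - 1) * ((u j - (u j * w)^-1) / 2).
  by rewrite /J uS /joukowski; field; rewrite ?u0 ?w0 ?pnatr_eq0.
have Jle j : normc (J j.+1 - J j) <= r * del.
  rewrite Jdiff !Normc.normcM mulrC ler_wpM2r ?normc_ge0 //.
  have -> : normc (2^-1 : R[i]) = 2^-1.
    have -> : (2 : R[i])^-1 = (2^-1)%:C by rewrite fmorphV rmorph_nat.
    by rewrite normc_real ger0_norm // invr_ge0.
  have := normcB (u j) (u j * w)^-1; rewrite Normc.normcV Normc.normcM nu w1 mulr1.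
  have : r^-1 < 1 by rewrite invf_lt1.
  by lra.
have Jy j : J j != y.
  rewrite -subr_eq0.
  have -> : J j - y = (u j - x) * (x * u j - 1) / (2 * (x * u j)).
    by rewrite /J /y /joukowski; field; rewrite ?u0 ?x0 ?pnatr_eq0.
  by rewrite !mulf_neq0 // invr_eq0 !mulf_neq0 // pnatr_eq0.
have poly : normc (\sum_(j < N) (g j - f y) * ((J j.+1 - J j) / (J j - y))) <=
    K * \sum_(j < N) normc (J j.+1 - J j) ^+ 2.
  apply: (polygon_cauchy f K d N J y K0 d0).
  - by rewrite /J uN.
  - by move=> j _; exact: Jy.
  - move=> j _; apply: le_lt_trans (Jle j) _.
    by rewrite -ltr_pdivlMl // mulrC; apply: lt_le_trans we ed.
  - move=> j t _ t01; apply: Hd; apply: ellipse_gauge_segment => //.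
      exact: inx.
    exact: inu.
pose ker j := cauchy_kernel (u j) x.
pose err j := (1 - w^-1) / (u j * ((u j - x) * (1 - (x * u j)^-1))).
have errle j : normc (err j) <= del by exact: (kernel_error_le _ _ _ _ r2 (nu j) x1 w1).
have S1 : normc (\sum_(j < N) (g j - f y) * (ker j + err j)) <= N%:R * (K * r ^+ 2 * del).
  have E : \sum_(j < N) (g j - f y) * ((J j.+1 - J j) / (J j - y)) =
      (w - 1) * \sum_(j < N) (g j - f y) * (ker j + err j).
    rewrite mulr_sumr; apply: eq_bigr => j _.
    by rewrite /J uS joukowski_kernel // mulrCA.
  move: poly; rewrite E Normc.normcM -/del => poly.
  rewrite -(ler_pM2l del0); apply: le_trans poly _.
  have -> : del * (N%:R * (K * r ^+ 2 * del)) = K * (N%:R * (r * del) ^+ 2) by ring.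
  rewrite ler_wpM2l // mulr_natl -[X in _ <= _ *+ X](card_ord N) -sumr_const.
  apply: ler_sum => j _.
  have rdel : 0 <= r * del by rewrite mulr_ge0 // ltW.
  by apply: lerXn2r; rewrite ?nnegrE ?normc_ge0 ?Jle.
have S2 : normc (\sum_(j < N) (g j - f y) * err j) <= N%:R * (2 * V * del).
  apply: le_trans (normc_sum _ _ _ _) _.
  rewrite mulr_natl -[X in _ <= _ *+ X](card_ord N) -sumr_const.
  apply: ler_sum => j _; rewrite Normc.normcM; apply: ler_pM; rewrite ?normc_ge0 //.
  by have := normcB (g j) (f y); have := gV j; clear -fyV; lra.
have S3 : normc (f y * (\sum_(j < N) ker j - N%:R)) <= N%:R * (V * (4 * r ^- N)).
  by rewrite Normc.normcM mulrCA; apply: ler_pM; rewrite ?normc_ge0.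
pose tail j := ker j - \sum_(k < M) laurent_basis k x * u j ^- k.
have S4 : normc (\sum_(j < N) g j * tail j) <= N%:R * (V * (4 * r ^- M)).
  apply: le_trans (normc_sum _ _ _ _) _.
  rewrite mulr_natl -[X in _ <= _ *+ X](card_ord N) -sumr_const.
  apply: ler_sum => j _; rewrite Normc.normcM; apply: ler_pM; rewrite ?normc_ge0 //.
  exact: cauchy_kernel_tail.
(* The approximant is the discrete Cauchy formula with a truncated kernel: the four
   sums below are its deviations from [f y]. *)
have key : N%:R * (f y - \sum_(k < M) laurent_basis k x *
      (N%:R^-1 * \sum_(j < N) g j * u j ^- k)) =
    \sum_(j < N) (g j - f y) * err j - \sum_(j < N) (g j - f y) * (ker j + err j)
    - f y * (\sum_(j < N) ker j - N%:R) + \sum_(j < N) g j * tail j.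
  rewrite mulrBr mulr_sumr.
  have -> : \sum_(k < M) N%:R * (laurent_basis k x *
      (N%:R^-1 * \sum_(j < N) g j * u j ^- k))
     = \sum_(j < N) g j * \sum_(k < M) laurent_basis k x * u j ^- k.
    under [RHS]eq_bigr do rewrite mulr_sumr.
    rewrite [RHS]exchange_big /=; apply: eq_bigr => k _.
    rewrite mulrCA mulVKf // mulr_sumr; apply: eq_bigr => j _.
    by rewrite mulrCA.
  have -> : \sum_(j < N) (g j - f y) * (ker j + err j) =
      \sum_(j < N) g j * ker j - f y * \sum_(j < N) ker j
      + \sum_(j < N) (g j - f y) * err j.
    rewrite mulr_sumr -sumrB -big_split /=; apply: eq_bigr => j _; ring.
  have -> : \sum_(j < N) g j * tail j = \sum_(j < N) g j * ker j -
      \sum_(j < N) g j * \sum_(k < M) laurent_basis k x * u j ^- k.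
    by rewrite -sumrB; apply: eq_bigr => j _; rewrite /tail mulrBr.
  ring.
rewrite -(ler_pM2l Nr).
have normcN z : N%:R * normc z = normc (N%:R * z).
  rewrite Normc.normcM -[N%:R : R[i]](rmorph_nat (real_complex R)).
  by rewrite normc_real ger0_norm.
rewrite normcN.
rewrite key; move: S1 S2 S3 S4.
set X1 := \sum_(j < N) _ * (_ + _); set X2 := \sum_(j < N) _ * err _.
set X3 := f y * _; set X4 := \sum_(j < N) _ * tail _ => S1 S2 S3 S4.
have T1 := normcD (X2 - X1 - X3) X4.
have T2 := normcB (X2 - X1) X3.
have T3 := normcB X2 X1.
have rN : r ^- N <= e.
  apply: le_trans (ltW Ne); rewrite lef_pV2 ?posrE ?exprn_gt0 //.
  apply: (@le_trans _ _ (2 ^+ N)); last by apply: lerXn2r; rewrite ?nnegrE //; lra.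
  by rewrite -natrX ler_nat ltnW // ltn_expl.
have small : K * r ^+ 2 * del + 2 * V * del + V * (4 * r ^- N) <= eta.
  apply: (@le_trans _ _ (c * e)); last by rewrite mulrC -ler_pdivlMr.
  have Kr : 0 <= K * r ^+ 2 by rewrite mulr_ge0 ?sqr_ge0.
  have h1 := ler_wpM2l Kr (ltW we); have h2 := ler_wpM2l V0 (ltW we).
  have h3 := ler_wpM2l V0 rN.
  rewrite -/del in h1 h2.
  have -> : c * e = K * r ^+ 2 * e + 6 * (V * e) + e by rewrite /c; ring.
  have -> : 2 * V * del = 2 * (V * del) by ring.
  have -> : V * (4 * r ^- N) = 4 * (V * r ^- N) by ring.
  by clear -h1 h2 h3 e0; lra.
have := ler_wpM2l (ltW Nr) small.
rewrite !mulrDr => small'.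
have -> : N%:R * (4 * V * r ^- M) = N%:R * (V * (4 * r ^- M)) by ring.
by clear -small' T1 T2 T3 S1 S2 S3 S4; lra.
Qed.

End BernsteinApproximation.

Section EllipseTransport.
Context {R : realType}.
Implicit Types (u v w z : R[i]).

Lemma bernoulli (t : R) n : 0 <= t <= 1 -> 1 - n%:R * t <= (1 - t) ^+ n.
Proof.
move=> /andP[t0 t1]; elim: n => [|n IH]; first by rewrite mul0r subr0 expr0.
have t1' : 0 <= 1 - t by lra.
rewrite exprS; apply: le_trans (ler_wpM2l t1' IH).
have -> : (1 - t) * (1 - n%:R * t) = 1 - n.+1%:R * t + n%:R * t ^+ 2.
  by rewrite -natr1; ring.
by rewrite lerDl mulr_ge0 ?sqr_ge0.
Qed.

(** Letting r be close to [rho] costs a factor two in the power and spares a limit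
    process in which the coefficients would have to converge. *)
Lemma bernstein_approx (f : R[i] -> R[i]) (V rho eta : R) M : 4 < rho ->
  (0 < M)%N -> 0 < eta ->
  (forall z, bernstein_unit rho z -> normc (f z) <= V /\ locally_second_diff f z) ->
  exists b : nat -> R[i], forall x, normc x = 1 ->
    normc (f (joukowski x) - \sum_(k < M) laurent_basis k x * b k)
      <= 8 * V * rho ^- M + eta.
Proof.
move=> rho4 M0 eta0 H.
have Mr : 1 <= M%:R :> R by rewrite ler1n.
(* The ellipse is shrunk just enough to stay inside the open one while costing a
   factor two: (1 - 1 / (2 M)) ^ M >= 1 / 2. *)
pose t := (2 * M%:R)^-1 : R.
have t0 : 0 < t by rewrite invr_gt0; lra.
have t2 : t <= 2^-1 by rewrite lef_pV2 ?posrE; lra.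
pose r := rho * (1 - t).
have r2 : 2 <= r by rewrite /r; nra.
have rrho : r < rho by rewrite /r; nra.
have V0 : 0 <= V.
  have : bernstein_unit rho 0.
    apply: (@closed_ellipse_sub _ r); rewrite /ellipse_gauge /= ?mul0r ?expr0n ?addr0 //.
    by lra.
  by move=> /H[+ _]; apply: le_trans; exact: normc_ge0.
have rM : r ^- M <= 2 * rho ^- M.
  rewrite exprMn invfM mulrC ler_wpM2r ?invr_ge0 ?exprn_ge0 //; first by lra.
  rewrite -[leRHS]invrK lef_pV2 ?posrE ?invr_gt0 ?exprn_gt0 //; last by lra.
  have : 0 <= t <= 1 by rewrite ltW //=; lra.
  move/(bernoulli t M); apply: le_trans.
  have -> : M%:R * t = 2^-1 by rewrite /t; field; rewrite gt_eqF //; lra.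
  by lra.
have [b Hb] := laurent_approx f V r eta M r2 M0 eta0
  (fun z hz => H z (closed_ellipse_sub r rho z ltac:(lra) rrho hz)).
exists b => x x1; apply: le_trans (Hb x x1) _; rewrite lerD2r.
have -> : 8 * V * rho ^- M = 4 * V * (2 * rho ^- M) by ring.
by rewrite ler_wpM2l // mulr_ge0.
Qed.

Lemma bernstein_mapE (lo hi : R) z :
  bernstein_map lo hi z = ((lo + hi) / 2)%:C + ((hi - lo) / 2)%:C * z.
Proof.
case: z => x y; rewrite /bernstein_map /=; apply/eqP; rewrite eq_complex /=.
by apply/andP; split; apply/eqP; field.
Qed.

Lemma normc_ge_absRe z : `|complex.Re z| <= normc z.
Proof.
case: z => x y; rewrite /Normc.normc /= -sqrtr_sqr ler_wsqrtr //.
by rewrite lerDl sqr_ge0.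
Qed.

Lemma normc_ge_absIm z : `|complex.Im z| <= normc z.
Proof.
case: z => x y; rewrite /Normc.normc /= -sqrtr_sqr ler_wsqrtr //.
by rewrite lerDr sqr_ge0.
Qed.

Lemma bernstein_unit_open (rho : R) z : bernstein_unit rho z ->
  exists2 e : R, 0 < e & forall w, normc (w - z) < e -> bernstein_unit rho w.
Proof.
move=> [a [b [a0 b0 ab abr]]]; set x := complex.Re z; set y := complex.Im z => g1.
pose C := (2 * `|x| + 1) / a ^+ 2 + (2 * `|y| + 1) / b ^+ 2.
have pos (s c : R) : 0 < c -> 0 < (2 * `|s| + 1) / c ^+ 2.
  by move=> c0; rewrite divr_gt0 ?exprn_gt0 //; have := normr_ge0 s; lra.
have C0 : 0 < C by rewrite addr_gt0 ?pos.
pose g := 1 - ((x / a) ^+ 2 + (y / b) ^+ 2).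
have g0 : 0 < g by rewrite subr_gt0.
exists (Num.min 1 (g / C)) => [|w]; first by rewrite lt_min ltr01 divr_gt0.
rewrite lt_min => /andP[w1 wg]; exists a, b; split => //.
have near_sq (s s' c e : R) : 0 < c -> `|s' - s| <= e -> e <= 1 ->
    (s' / c) ^+ 2 <= (s / c) ^+ 2 + e * ((2 * `|s| + 1) / c ^+ 2).
  move=> c0 ss e1; rewrite !exprMn !exprVn mulrA -mulrDl.
  rewrite ler_wpM2r ?invr_ge0 ?exprn_ge0 // ?(ltW c0) //.
  have -> : s' ^+ 2 = s ^+ 2 + (s' - s) * (2 * s + (s' - s)) by ring.
  rewrite lerD2l; apply: le_trans (ler_norm _) _; rewrite normrM.
  apply: ler_pM => //; apply: le_trans (ler_normD _ _) _.
  by rewrite normrM ger0_norm // lerD2l (le_trans ss).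
have hx := near_sq x (complex.Re w) a (normc (w - z)) a0.
have hy := near_sq y (complex.Im w) b (normc (w - z)) b0.
have {}hx := hx ltac:(by have := normc_ge_absRe (w - z); rewrite raddfB) (ltW w1).
have {}hy := hy ltac:(by have := normc_ge_absIm (w - z); rewrite raddfB) (ltW w1).
have : normc (w - z) * C < g by rewrite -ltr_pdivlMr.
by rewrite /C mulrDr /g; clear -hx hy; lra.
Qed.

Lemma bernstein_ellipse_interior (A : set R) (rho : R) z :
  inf A < sup A -> bernstein_unit rho z ->
  (bernstein_ellipse A rho)° (bernstein_map (inf A) (sup A) z).
Proof.
move=> lohi /bernstein_unit_open[e e0 eP].
pose s := (sup A - inf A) / 2; have s0 : 0 < s by rewrite divr_gt0 // subr_gt0.
have sC : s%:C != 0 :> R[i] by rewrite eq_complex /= gt_eqF.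
apply/nbhs_normcP; exists (s * e); first by rewrite mulr_gt0.
move=> w wz; exists ((w - ((inf A + sup A) / 2)%:C) / s%:C); last first.
  by rewrite bernstein_mapE -/s [s%:C * _]mulrC divfK // addrC subrK.
apply: eP; rewrite -(ltr_pM2l s0) -[X in X * normc _](gtr0_norm s0).
rewrite -normc_real -Normc.normcM mulrBr [s%:C * (_ / _)]mulrC divfK //.
by move: wz; rewrite bernstein_mapE -/s opprD addrA.
Qed.

Lemma second_diff_bound_affine (f : R[i] -> R[i]) (m s d K : R) u : 0 < s ->
  second_diff_bound f d K (m%:C + s%:C * u) ->
  second_diff_bound (fun z => f (m%:C + s%:C * z)) (d / s) (K * s ^+ 2) u.
Proof.
move=> s0 H v1 v2 h1 h2.
have E v v' : m%:C + s%:C * v - (m%:C + s%:C * v') = s%:C * (v - v') by ring.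
have sn v : normc (s%:C * v) = s * normc v.
  by rewrite Normc.normcM normc_real gtr0_norm.
have := H (m%:C + s%:C * v1) (m%:C + s%:C * v2).
rewrite !E !sn => HH.
have {}HH := HH ltac:(by rewrite mulrC -ltr_pdivlMr) ltac:(by rewrite mulrC -ltr_pdivlMr).
rewrite -(ler_pM2l s0) -sn.
set p := normc (v1 - u) in HH *; set q := normc (v2 - u) in HH *.
set t := normc (v1 - v2) in HH *.
have -> : s * (K * s ^+ 2 * (p * q * t)) = K * (s * p * (s * q) * (s * t)) by ring.
by apply: le_trans _ HH; rewrite mulrBr ![s%:C * (_ * _)]mulrCA.
Qed.

End EllipseTransport.

(** * Separable approximation from analyticity in one variable *)

Section SeparableApproximation.
Context {R : realType} {T2 : Type}.

Lemma supnorm_ge (T : Type) (X : set T) (f : T -> R[i]^o) x : X x ->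
  ((normc (f x))%:E <= supnorm X f)%E.
Proof. by move=> Xx; apply: ereal_sup_ubound; exists x. Qed.

Lemma supnorm_le (T : Type) (X : set T) (f : T -> R[i]^o) (B : \bar R) :
  (forall x, X x -> ((normc (f x))%:E <= B)%E) -> (supnorm X f <= B)%E.
Proof. by move=> H; apply: ge_ereal_sup => _ [x Xx <-]; exact: H. Qed.

(** For each value of the second argument the analytic factor is approximated in the
    first one by the same M functions; the coefficients, multiplied by the second
    factor, may depend on that value in any way. *)
Lemma separable_approx (rho : R) (X1 : set R) (X2 : set T2)
    (f : R -> T2 -> R[i]^o) :
  4 < rho -> compact X1 ->
  analytic_property_fst (bernstein_ellipse X1 rho) X1 X2 f ->
  (exists x1 x2, [/\ X1 x1, X2 x2 & f x1 x2 != 0]) ->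
  exists2 C : R, 0 < C & forall M, (0 < M)%N ->
    exists (a : nat -> R -> R[i]) (b : nat -> T2 -> R[i]),
    forall x1 x2, X1 x1 -> X2 x2 ->
      normc (f x1 x2 - \sum_(k < M) a k x1 * b k x2) <= C * rho ^- M.
Proof.
move=> rho4 cX1 [inY [f1 [f2 [fE an fin]]]] [p1 [p2 [Xp1 Xp2 fp]]].
have rho0 : 0 < rho by lra.
have [V1 [V2 [V1P V2P]]] : exists V1 V2 : R,
   (forall z x, bernstein_ellipse X1 rho z -> X2 x -> normc (f1 z x) <= V1) /\
   (forall x, X2 x -> normc (f2 x) <= V2).
  set S1 := supnorm _ _ in fin; set S2 := supnorm _ _ in fin.
  have h1 := supnorm_ge _ _ (fun x => f1 x.1 x.2) (p1%:C, p2)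
    (conj (inY _ Xp1) Xp2 : (_ `*` X2) (p1%:C, p2)).
  have h2 := supnorm_ge _ _ f2 _ Xp2.
  move: fp; rewrite fE // mulf_eq0 negb_or -!normc_gt0 => /andP[n1 n2].
  have S10 : (0 < S1)%E by apply: lt_le_trans h1; rewrite lte_fin.
  have S20 : (0 < S2)%E by apply: lt_le_trans h2; rewrite lte_fin.
  have b1 z x : bernstein_ellipse X1 rho z -> X2 x -> ((normc (f1 z x))%:E <= S1)%E.
    by move=> Yz Xx; exact: (supnorm_ge _ _ (fun x => f1 x.1 x.2) (z, x)).
  have b2 x : X2 x -> ((normc (f2 x))%:E <= S2)%E by exact: supnorm_ge.
  clearbody S1 S2; move: S1 S2 fin S10 S20 b1 b2 {h1 h2} => [s1| |] [s2| |] //=.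
  - by move=> _ _ _ b1 b2; exists s1, s2; split=> *; rewrite -lee_fin; auto.
  - by move=> + s10; rewrite gt0_muley.
  - by move=> + _ s20; rewrite gt0_mulye.
have V10 : 0 <= V1 by apply: le_trans (normc_ge0 _) (V1P _ _ (inY _ Xp1) Xp2).
have V20 : 0 <= V2 by apply: le_trans (normc_ge0 _) (V2P _ Xp2).
exists ((8 * V1 + 1) * V2 + 1).
  by rewrite ltr_wpDl // mulr_ge0 // addr_ge0 // mulr_ge0.
move=> M M0.
have X1n : X1 !=set0 by exists p1.
have [M' [_ bndX]] := compact_bounded cX1.
have [lb ub] : has_lbound X1 /\ has_ubound X1.
  have := bndX (M' + 1) ltac:(lra) => bX.
  split; [exists (- (M' + 1)) | exists (M' + 1)] => x /bX /=;
    by rewrite ler_norml => /andP[].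
have inE x : X1 x -> inf X1 <= x <= sup X1.
  by move=> Xx; rewrite ge_inf // ub_le_sup.
have rM : 0 < rho ^- M by rewrite invr_gt0 exprn_gt0.
(* When X1 is a single point the ellipse degenerates and carries no analyticity,
   but then [f] itself is separable of rank one. *)
have [lohi|hilo] := ltP (inf X1) (sup X1); last first.
  have X1E x : X1 x -> x = p1.
    move=> Xx; have := inE _ Xx; have := inE _ Xp1; lra.
  exists (fun k _ => (k == 0%N)%:R), (fun _ x2 => f p1 x2) => x1 x2 /X1E -> _.
  case: M M0 rM => // M _ rM; rewrite big_ord_recl /= mul1r big1 => [|k _].
    rewrite addr0 subrr Normc.normc0 mulr_ge0 ?(ltW rM) // addr_ge0 //.
    by rewrite mulr_ge0 // addr_ge0 // mulr_ge0.
  by rewrite mul0r.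
pose m := (inf X1 + sup X1) / 2; pose s := (sup X1 - inf X1) / 2.
have s0 : 0 < s by rewrite divr_gt0 // subr_gt0.
have circ x : exists u : R[i], X1 x -> normc u = 1 /\ joukowski u = ((x - m) / s)%:C.
  have [Xx|nX] := pselect (X1 x); last by exists 0.
  have : -1 <= (x - m) / s <= 1.
    rewrite ler_pdivlMr // ler_pdivrMr // mulN1r mul1r.
    by have := inE _ Xx; rewrite /m /s; lra.
  by move=> /joukowski_surj[u u1 uE]; exists u.
have [c cP] := choice circ.
pose g x2 z := f1 (m%:C + s%:C * z) x2.
have coef x2 : exists b : nat -> R[i], X2 x2 -> forall x, normc x = 1 ->
    normc (g x2 (joukowski x) - \sum_(k < M) laurent_basis k x * b k) <=
    8 * V1 * rho ^- M + rho ^- M.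
  have [Xx|nX] := pselect (X2 x2); last by exists (fun=> 0).
  have [z zE|b bP] := bernstein_approx (g x2) V1 rho (rho ^- M) M rho4 M0 rM.
    have TE : m%:C + s%:C * z = bernstein_map (inf X1) (sup X1) z.
      by rewrite bernstein_mapE.
    split; first by rewrite /g TE; apply: V1P => //; exists z.
    have := an _ Xx _ (bernstein_ellipse_interior _ _ _ lohi zE).
    rewrite -TE => /analytic_second_diff_bound[K [d [d0 Hd]]].
    exists (K * s ^+ 2), (d / s); split; first by rewrite divr_gt0.
    move=> u uz; apply: (second_diff_bound_affine (f1^~ x2) m s d K u s0); apply: Hd.
    rewrite [X in normc X](_ : _ = s%:C * (u - z)); last by ring.
    by rewrite Normc.normcM normc_real gtr0_norm // mulrC -ltr_pdivlMr.
  by exists b.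
have [b bP] := choice coef.
exists (fun k x => laurent_basis k (c x)), (fun k x2 => b x2 k * f2 x2).
move=> x1 x2 Xx1 Xx2; rewrite fE //.
have [c1 cE] := cP _ Xx1.
have -> : x1%:C = m%:C + s%:C * joukowski (c x1).
  by rewrite cE -rmorphM -rmorphD /= mulrC divfK ?gt_eqF // addrC subrK.
rewrite -/(g x2 (joukowski (c x1))).
under eq_bigr do rewrite mulrA.
rewrite -mulr_suml -mulrBl Normc.normcM.
apply: (@le_trans _ _ ((8 * V1 * rho ^- M + rho ^- M) * V2)).
  by apply: ler_pM; rewrite ?normc_ge0 ?V2P ?bP.
have -> : ((8 * V1 + 1) * V2 + 1) * rho ^- M =
  (8 * V1 * rho ^- M + rho ^- M) * V2 + rho ^- M by ring.
by rewrite lerDl ltW.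
Qed.

End SeparableApproximation.

(** * Integration of complex functions *)

Section ComplexIntegral.
Context {R : realType} {T2 : ptopologicalType}.
Variables (Om : set T2) (A : set (set T2)).
Variable mu : {measure set (g_sigma_algebraType A) -> \bar R}.
Hypothesis mOm : measurable (Om : set (g_sigma_algebraType A)).
Hypothesis muOm : (mu Om < +oo)%E.

Definition cintegrable (g : T2 -> R[i]^o) :=
  mu.-integrable Om (EFin \o (fun z => complex.Re (g z))) /\
  mu.-integrable Om (EFin \o (fun z => complex.Im (g z))).

Lemma eq_cintegrable (f g : T2 -> R[i]^o) : (forall z, Om z -> f z = g z) ->
  cintegrable f -> cintegrable g.
Proof.
move=> fg [h1 h2]; split.
  by apply: (eq_integrable mOm _ _ _ h1) => z /set_mem Oz /=; rewrite fg.
by apply: (eq_integrable mOm _ _ _ h2) => z /set_mem Oz /=; rewrite fg.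
Qed.

Lemma cintegrableD (f g : T2 -> R[i]^o) : cintegrable f -> cintegrable g ->
  cintegrable (fun z => f z + g z).
Proof.
move=> [f1 f2] [g1 g2]; split.
  apply: (eq_integrable mOm _ _ _ (integrableD mOm f1 g1)) => z _ /=.
  by rewrite -EFinD; case: (f z) (g z) => ? ? [].
apply: (eq_integrable mOm _ _ _ (integrableD mOm f2 g2)) => z _ /=.
by rewrite -EFinD; case: (f z) (g z) => ? ? [].
Qed.

Lemma cintegrableZ (c : R[i]) (f : T2 -> R[i]^o) : cintegrable f ->
  cintegrable (fun z => c * f z).
Proof.
case: c => a b [f1 f2]; split.
  apply: (eq_integrable mOm _ _ _ (integrableB mOm (integrableZl mOm a f1)
    (integrableZl mOm b f2))) => z _ /=.
  by rewrite -!EFinM -EFinB; case: (f z).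
apply: (eq_integrable mOm _ _ _ (integrableD mOm (integrableZl mOm a f2)
  (integrableZl mOm b f1))) => z _ /=.
by rewrite -!EFinM -EFinD; case: (f z).
Qed.

Lemma cintegrable_sum (M : nat) (c : nat -> R[i]) (f : nat -> T2 -> R[i]^o) :
  (forall j, (j < M)%N -> cintegrable (f j)) ->
  cintegrable (fun z => \sum_(j < M) c j * f j z).
Proof.
elim: M => [_|M IH H].
  apply: (@eq_cintegrable (fun=> 0)) => [z _|]; first by rewrite big_ord0.
  by split; apply: (eq_integrable mOm _ _ _ (integrable0 _ _)).
apply: (@eq_cintegrable (fun z => \sum_(j < M) c j * f j z + c M * f M z)).
  by move=> z _; rewrite big_ord_recr.
apply: cintegrableD; first by apply: IH => j jM; apply: H; exact: ltnW.
by apply: cintegrableZ; exact: H.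
Qed.

(** The half-planes on which the real or imaginary part exceeds a level are open, so
    Borel measurability in the plane passes to the two parts. *)
Lemma cintegrable_bounded (f : T2 -> R[i]^o) (B : R) :
  @measurable_fun _ _ (g_sigma_algebraType A)
      (g_sigma_algebraType (@open R[i]^o)) Om f ->
  (forall z, Om z -> normc (f z) <= B) -> cintegrable f.
Proof.
move=> mf fB.
have part (g : R[i] -> R) : (forall x y, `|g x - g y| <= normc (x - y)) ->
    (forall x, `|g x| <= normc x) ->
    mu.-integrable Om (EFin \o (fun z => g (f z))).
  move=> glip g0.
  apply: measurable_bounded_integrable => //.
    apply: (measurability _ (RGenOInfty.measurableE R)) => _ [_ [x ->] <-].
    have -> : Om `&` (fun z => g (f z)) @^-1` `]x, +oo[%classic =
        Om `&` f @^-1` [set u | x < g u].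
      by apply/seteqP; split => z [Oz] /=; rewrite in_itv /= andbT.
    apply: mf => //; apply: sub_sigma_algebra.
    rewrite openE => u /= xu; apply/nbhs_normcP.
    exists (g u - x) => [|v uv]; first by rewrite subr_gt0.
    have := glip u v; have := ler_norm (g u - g v); rewrite /= normc_sub; lra.
  exists B; split; first exact: num_real.
  move=> t Bt z Oz /=; apply: le_trans (g0 _) _; apply: le_trans (fB _ Oz) _.
  exact: ltW.
split; apply: part.
- by move=> x y; have := normc_ge_absRe (x - y); rewrite raddfB.
- exact: normc_ge_absRe.
- by move=> x y; have := normc_ge_absIm (x - y); rewrite raddfB.
- exact: normc_ge_absIm.
Qed.

Lemma cintegralB (f g : T2 -> R[i]^o) : cintegrable f -> cintegrable g ->
  cintegral Om mu f - cintegral Om mu g = cintegral Om mu (fun z => f z - g z).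
Proof.
move=> [f1 f2] [g1 g2]; rewrite /cintegral.
apply/eqP; rewrite eq_complex /= -!RintegralB //.
apply/andP; split; apply/eqP; apply: eq_Rintegral => z _;
  by case: (f z) (g z) => ? ? [].
Qed.

(** The factor 2 comes from estimating the real and imaginary parts separately. *)
Lemma cintegral_bound (f : T2 -> R[i]^o) (B : R) : cintegrable f ->
  (forall z, Om z -> normc (f z) <= B) ->
  normc (cintegral Om mu f) <= 2 * B * fine (mu Om).
Proof.
move=> [f1 f2] fB; rewrite /cintegral; apply: le_trans (normc_le_ReIm _ _) _.
have cB : mu.-integrable Om (EFin \o (fun=> B)).
  apply: measurable_bounded_integrable => //.
  by exists `|B|; split => // t Bt z _; exact: ltW.
have part (g : T2 -> R) : mu.-integrable Om (EFin \o g) ->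
    (forall z, Om z -> `|g z| <= B) ->
    `| \int[mu]_(z in Om) g z | <= B * fine (mu Om).
  move=> ig gB; apply: le_trans (le_normr_Rintegral mOm ig) _.
  rewrite -Rintegral_cst //; apply: le_Rintegral => //.
  exact: integrable_norm ig.
rewrite -mulrA mulr_natl mulr2n; apply: lerD; apply: part => // z Oz.
  exact: le_trans (normc_ge_absRe _) (fB _ Oz).
exact: le_trans (normc_ge_absIm _) (fB _ Oz).
Qed.

End ComplexIntegral.

(** * Convergence of the interpolation *)

Section Convergence.
Context {R : realType} {T1 : topologicalType} {T2 : ptopologicalType}.
Variables (P : set T1) (Om : set T2) (A : set (set T2)).
Variable mu : {measure set (g_sigma_algebraType A) -> \bar R}.
Variable h : T1 -> T2 -> R[i]^o.

(** On the domain each basis function is a combination of one h_p and of the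
    earlier basis functions. *)
Lemma magic_interp_cintegrable (ps : nat -> T1) (zs : nat -> T2)
    (qs : nat -> T2 -> R[i]^o) (M : nat) :
  measurable (Om : set (g_sigma_algebraType A)) ->
  (forall p, P p -> cintegrable Om A mu (h p)) ->
  magic_construction P Om h ps zs qs M ->
  forall p, cintegrable Om A mu (magic_interp h zs qs M p).
Proof.
move=> mOm ih constr.
have interp_int m : (forall j, (j < m)%N -> cintegrable Om A mu (qs j)) ->
    forall p, cintegrable Om A mu (magic_interp h zs qs m p).
  move=> iq p; have [c [cE _]] := magic_interp_span h zs qs m p.
  apply: (eq_cintegrable _ _ _ mOm (fun z => \sum_(j < m) c j * qs j z)).
    by move=> z _; rewrite cE.
  exact: cintegrable_sum.
have iq j : (j < M)%N -> cintegrable Om A mu (qs j).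
  elim/ltn_ind: j => j IH jM.
  pose d := (magic_residual h zs qs j (ps j) (zs j))^-1.
  apply: (eq_cintegrable _ _ _ mOm (fun z => d * (h (ps j) z +
      -1 * magic_interp h zs qs j (ps j) z))).
    move=> z Oz; rewrite (magic_basisE _ _ _ _ _ _ _ constr) //.
    by rewrite mulN1r mulrC.
  apply: cintegrableZ => //; apply: cintegrableD => //.
    by apply: ih; exact: (magic_param_in _ _ _ _ _ _ _ constr).
  apply: cintegrableZ => //; apply: interp_int => i ij.
  by apply: IH => //; exact: ltn_trans jM.
exact: interp_int.
Qed.

(** The power of rho / 4 combines the decay rho ^ -M of the separable approximation
    with the loss 4 ^ M of the greedy choice. *)
Lemma magic_convergence_of_separable (rho : R) : 0 < rho ->
  magic_setting P Om mu h ->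
  (exists2 C : R, 0 < C & forall M, (0 < M)%N ->
    exists (a : nat -> T1 -> R[i]) (b : nat -> T2 -> R[i]),
    forall p z, P p -> Om z ->
      normc (h p z - \sum_(k < M) a k p * b k z) <= C * rho ^- M) ->
  magic_convergence P Om mu h rho.
Proof.
move=> rho0 [_ _ _ sA muOm hbnd hmeas _ [p0 [z0 [Pp0 Oz0 _]]]] [C C0 sep].
have mOm : measurable (Om : set (g_sigma_algebraType A)).
  apply: sub_sigma_algebra; case: sA => A0 AC _.
  by have := AC _ A0; rewrite setD0.
have ih p : P p -> cintegrable Om A mu (h p).
  move=> Pp; set S := supnorm _ _ in hbnd.
  have Sge z : Om z -> ((normc (h p z))%:E <= S)%E.
    by move=> Oz; exact: (supnorm_ge _ _ (fun x => h x.1 x.2) (p, z)).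
  apply: (cintegrable_bounded _ _ _ mOm muOm _ (fine S)); first exact: hmeas.
  move=> z Oz; rewrite -lee_fin fineK; first exact: Sge.
  rewrite ge0_fin_numE //; apply: le_trans (Sge _ Oz0).
  by rewrite lee_fin normc_ge0.
move=> ps zs qs; exists (4 * C); first by rewrite mulr_gt0.
move=> M M0 constr; have [a [b ab]] := sep M M0.
set q := (rho / 4) ^- M.
have q0 : 0 < q by rewrite invr_gt0 exprn_gt0 // divr_gt0.
have M1 : 1 <= M%:R :> R by rewrite ler1n.
have resB p z : P p -> Om z ->
    normc (magic_residual h zs qs M p z) <= 2 * C * q.
  move=> Pp Oz; apply: le_trans
    (magic_residual_rank_bound _ _ _ _ _ _ M constr _ a b ab p z Pp Oz) _.
  by rewrite /q exprMn exprVn invfM invrK le_eqVlt; apply/orP; left; apply/eqP; ring.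
split.
  apply: supnorm_le => -[p z] [/= Pp Oz]; rewrite lee_fin.
  apply: le_trans (resB p z Pp Oz) _; rewrite ler_wpM2r ?(ltW q0) //.
  by rewrite -mulrA mulrC; nra.
have muf : mu Om \is a fin_num by rewrite ge0_fin_numE.
apply: supnorm_le => p Pp.
rewrite -(fineK muf) -!EFinM lee_fin.
have iI := magic_interp_cintegrable _ _ _ _ mOm ih constr p.
rewrite cintegralB //; last exact: ih.
have iR : cintegrable Om A mu (magic_residual h zs qs M p).
  apply: (eq_cintegrable _ _ _ mOm (fun z => h p z + -1 * magic_interp h zs qs M p z)).
    by move=> z _; rewrite mulN1r.
  by apply: cintegrableD => //; [exact: ih | exact: cintegrableZ].
apply: le_trans (cintegral_bound _ _ _ mOm muOm _ _ iR (resB p ^~ Pp)) _.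
have f0 : 0 <= fine (mu Om) by rewrite fine_ge0.
have -> : 2 * (2 * C * q) * fine (mu Om) = 4 * C * fine (mu Om) * (1 * q) by ring.
by rewrite ler_wpM2l ?mulr_ge0 ?(ltW C0) // ler_wpM2r // ltW.
Qed.

End Convergence.

Theorem theorem3p2 (R : realType) (rho : R) (rho_gt4 : 4 < rho) :
  (* (a) Omega is a compact subset of the real line *)
  (forall (K : numFieldType) (V : normedModType K) (P : set V)
      (Om : set R) (A : set (set R))
      (mu : {measure set (g_sigma_algebraType A) -> \bar R})
      (h : V -> R -> R[i]^o),
    magic_setting P Om mu h ->
    analytic_property_snd (bernstein_ellipse Om rho) P Om h ->
    magic_convergence P Om mu h rho)
  /\
  (* (b) P is a compact subset of the real line *)
  (forall (d : nat) (P : set R)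
      (Om : set 'rV[R[i]^o]_d) (A : set (set 'rV[R[i]^o]_d))
      (mu : {measure set (g_sigma_algebraType A) -> \bar R})
      (h : R -> 'rV[R[i]^o]_d -> R[i]^o),
    magic_setting P Om mu h ->
    analytic_property_fst (bernstein_ellipse P rho) P Om h ->
    magic_convergence P Om mu h rho).
Proof.
have rho0 : 0 < rho by lra.
split.
  move=> K V P Om A mu h set_h an.
  apply: magic_convergence_of_separable => //.
  have [_ cOm _ _ _ _ _ _ [p [z [Pp Oz hpz]]]] := set_h.
  have [C C0 HC] := separable_approx rho Om P (fun z p => h p z) rho_gt4 cOm an
    (ex_intro _ z (ex_intro _ p (And3 Oz Pp hpz))).
  exists C => // M /HC[a [b ab]]; exists b, a => p' z' Pp' Oz'.
  by under eq_bigr do rewrite mulrC; exact: ab.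
move=> d P Om A mu h set_h an.
apply: magic_convergence_of_separable => //.
have [cP _ _ _ _ _ _ _ [p [z [Pp Oz hpz]]]] := set_h.
by apply: separable_approx => //; exists p, z.
Qed.
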